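(* Let $\Gamma=H_1*_K H_2$ be an amalgamated free product of abstract groups, where $K$ is a common subgroup of $H_1$ and $H_2$, and fix a prime $p$. Put $P=\widehat\Gamma_p$, let $\rho:\Gamma\to P$ be the canonical map, and set $V_i=\overline{\rho(H_i)}$ for $i=1,2$ and $B=V_1\cap V_2$. Assume that $H_1$ and $H_2$ are boundedly generated. Then $P$ is boundedly generated if and only if one of the following holds: (a) $B=V_1$ or $B=V_2$; (b) $p=2$ and $[V_1:B]=[V_2:B]=2$.
   Context: An abstract group $G$ is boundedly generated if $G=\langle g_1\rangle\cdots\langle g_d\rangle$ for finitely many $g_1,\dots,g_d\in G$. A profinite group $G$ is boundedly generated if $G=\overline{\langle g_1\rangle}\cdots\overline{\langle g_d\rangle}$ for finitely many $g_1,\dots,g_d\in G$. $\widehat\Gamma_p$ denotes the pro-$p$ completion of $\Gamma$, and bars denote closures. *)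

(* Defs.v *)
From HB Require Import structures.
From mathcomp Require Import all_boot all_classical topology.

Set Implicit Arguments.
Unset Strict Implicit.
Unset Printing Implicit Defensive.

Local Open Scope classical_set_scope.
Local Open Scope card_scope.
Local Open Scope quotient_scope.
Local Open Scope group_scope.

HB.mixin Record isTopologicalGroup G of Group G & Topological G := {
  mulg_continuous : continuous (fun xy : G * G => xy.1 * xy.2 : G);
  invg_continuous : continuous (fun x : G => x^-1 : G)
}.

#[short(type="topologicalGroupType")]
HB.structure Definition TopologicalGroup :=
  {G of isTopologicalGroup G & Group G & Topological G}.

HB.mixin Record isProfinite G of TopologicalGroup G := {
  profinite_compact : compact [set: G];
  profinite_hausdorff : hausdorff_space G;
  profinite_totally_disconnected : totally_disconnected [set: G]
}.

#[short(type="profiniteGroupType")]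
HB.structure Definition ProfiniteGroup :=
  {G of isProfinite G & TopologicalGroup G}.

Section BoundedGeneration.
Variable G : groupType.

Definition cyclic_subgroup (g : G) : set G :=
  [set x | exists n : nat, x = g ^+ n \/ x = g ^- n].

Definition mul_set (A B : set G) : set G := [set a * b | a in A & b in B].

Definition prod_sets (s : seq (set G)) : set G := foldr mul_set [set 1] s.

Definition boundedly_generated : Prop :=
  exists s : seq G, prod_sets [seq cyclic_subgroup g | g <- s] = [set: G].

End BoundedGeneration.

Definition profinite_boundedly_generated (G : profiniteGroupType) : Prop :=
  exists s : seq G,
    prod_sets [seq closure (cyclic_subgroup g) | g <- s] = [set: G].

Section Index.
Variable G : groupType.

Definition is_subgroup (A : set G) : Prop :=
  A 1 /\ forall x y, A x -> A y -> A (x / y).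

Definition left_cosets (A B : set G) : set (set G) :=
  [set [set a * b | b in B] | a in A].

(* Meaningful for subgroups B of A: [A : B] is finite and equal to n. *)
Definition has_index (A B : set G) (n : nat) : Prop :=
  left_cosets A B #= `I_n.

End Index.

(* (G; i1, i2) is the pushout of the two embeddings of K, that is, G is the
   amalgamated free product H1 *_K H2 up to a unique isomorphism. *)
Definition is_amalgam (K H1 H2 G : groupType)
    (j1 : {multiplicative K -> H1}) (j2 : {multiplicative K -> H2})
    (i1 : {multiplicative H1 -> G}) (i2 : {multiplicative H2 -> G}) : Prop :=
  [/\ injective j1, injective j2, i1 \o j1 =1 i2 \o j2 &
      forall (T : groupType) (f1 : {multiplicative H1 -> T})
             (f2 : {multiplicative H2 -> T}),
        f1 \o j1 =1 f2 \o j2 ->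
        exists f : {multiplicative G -> T},
          [/\ f \o i1 =1 f1, f \o i2 =1 f2 &
              forall g : {multiplicative G -> T},
                g \o i1 =1 f1 -> g \o i2 =1 f2 -> g =1 f]].

Section PNormal.
Variables (p : nat) (G : groupType).

(* The normal subgroups of G whose index is a power of p. *)
Record pnormal := PNormal {
  pnormal_set : set G;
  pnormal_subgroup : is_subgroup pnormal_set;
  pnormal_conj : forall x y, pnormal_set x -> pnormal_set (x ^ y);
  pnormal_index : exists k, has_index [set: G] pnormal_set (p ^ k)%N
}.

Variable P : pnormal.
Local Notation N := (pnormal_set P).

Lemma pnormal1 : N 1. Proof. by case: (pnormal_subgroup P). Qed.

Lemma pnormalV x : N x -> N x^-1.
Proof. by case: (pnormal_subgroup P) => N1 ND /(ND 1 x N1); rewrite div1g. Qed.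

Lemma pnormalM x y : N x -> N y -> N (x * y).
Proof.
case: (pnormal_subgroup P) => _ ND Nx /pnormalV Ny.
by have := ND _ _ Nx Ny; rewrite invgK.
Qed.

Definition coset_rel : rel G := fun x y => `[< N (x^-1 * y) >].

Lemma coset_rel_equiv : equiv_class_of coset_rel.
Proof.
split=> [x|x y|y x z]; rewrite /coset_rel.
- by apply/asboolP; rewrite mulVg; exact: pnormal1.
- by apply/asboolP/asboolP => /pnormalV; rewrite invgM invgK.
- move=> /asboolP Nxy /asboolP Nyz; apply/asboolP.
  by have := pnormalM Nxy Nyz; rewrite -mulgA mulVKg.
Qed.

Canonical coset_rel_equiv_rel := EquivRelPack coset_rel_equiv.

Definition quot := {eq_quot coset_rel}.
HB.instance Definition _ := Choice.on quot.
HB.instance Definition _ := EqQuotient.on quot.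

Lemma eq_quotP (x y : G) : \pi_quot x = \pi_quot y <-> N (x^-1 * y).
Proof. by split=> [/eqmodP/asboolP|Nxy] //; apply/eqmodP/asboolP. Qed.

Definition quot_mul (a b : quot) : quot := \pi_quot (repr a * repr b).
Definition quot_inv (a : quot) : quot := \pi_quot (repr a)^-1.

Lemma pi_quot_mul x y :
  quot_mul (\pi_quot x) (\pi_quot y) = \pi_quot (x * y).
Proof.
apply/eq_quotP; case: piP => x' /eq_quotP Nx; case: piP => y' /eq_quotP Ny.
move: (pnormalV Nx) (pnormalV Ny); rewrite !invgM !invgK => {}Nx {}Ny.
have -> : y'^-1 * x'^-1 * (x * y) = (y'^-1 * y) * (x'^-1 * x) ^ y.
  by rewrite /conjg !mulgA mulgK.
by apply: pnormalM => //; exact: pnormal_conj.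
Qed.

Lemma pi_quot_inv x : quot_inv (\pi_quot x) = \pi_quot x^-1.
Proof.
apply/eq_quotP; case: piP => x' /eq_quotP/pnormalV.
rewrite !invgM !invgK => /(@pnormal_conj P _ x'^-1).
by rewrite /conjg invgK !mulgA mulgV mul1g => /pnormalV; rewrite invgM !invgK.
Qed.

Fact pi_quot_surj (a : quot) : exists x, a = \pi_quot x.
Proof. by exists (repr a); rewrite reprK. Qed.

Fact quot_mulA : associative quot_mul.
Proof.
move=> a b c; have [x ->] := pi_quot_surj a; have [y ->] := pi_quot_surj b.
have [z ->] := pi_quot_surj c.
by rewrite !pi_quot_mul mulgA.
Qed.

Fact quot_mul1g : left_id (\pi_quot 1) quot_mul.
Proof.
by move=> a;
  have [x ->] := pi_quot_surj a; rewrite pi_quot_mul mul1g.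
Qed.

Fact quot_mulg1 : right_id (\pi_quot 1) quot_mul.
Proof.
by move=> a;
  have [x ->] := pi_quot_surj a; rewrite pi_quot_mul mulg1.
Qed.

Fact quot_mulVg : left_inverse (\pi_quot 1) quot_inv quot_mul.
Proof.
by move=> a;
  have [x ->] := pi_quot_surj a; rewrite pi_quot_inv pi_quot_mul mulVg.
Qed.

Fact quot_mulgV : right_inverse (\pi_quot 1) quot_inv quot_mul.
Proof.
by move=> a;
  have [x ->] := pi_quot_surj a; rewrite pi_quot_inv pi_quot_mul mulgV.
Qed.

HB.instance Definition _ :=
  isGroup.Build quot quot_mulA quot_mul1g quot_mulg1 quot_mulVg quot_mulgV.

End PNormal.

Section ProPCompletion.
Variables (p : nat) (G : groupType).
Implicit Types N M : pnormal p G.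

(* The projection G/N -> G/M; only meaningful when N is contained in M. *)
Definition quot_map N M (a : quot N) : quot M := \pi_(quot M) (repr a).

Definition quot_product : Type :=
  prod_topology (fun N : pnormal p G => discrete_topology (quot N)).
HB.instance Definition _ := Topological.on quot_product.

Definition inverse_limit : set quot_product :=
  [set x | forall N M, pnormal_set N `<=` pnormal_set M ->
             quot_map M (x N) = x M].

(* The inverse limit of the discrete finite p-groups G/N, with the topology
   induced by the product topology. *)
Definition pro_p_completion : Type := set_type inverse_limit.
HB.instance Definition _ := Topological.on pro_p_completion.

Lemma quot_map_pi N M g : pnormal_set N `<=` pnormal_set M ->
  quot_map M (\pi_(quot N) g) = \pi_(quot M) g.
Proof.
by move=> NM; apply/eq_quotP; case: piP => h /eq_quotP/pnormalV/NM;
   rewrite invgM invgK.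
Qed.

Lemma quot_mapM N M (a b : quot N) : pnormal_set N `<=` pnormal_set M ->
  quot_map M (a * b) = quot_map M a * quot_map M b.
Proof.
move=> NM; have [x ->] := pi_quot_surj a; have [y ->] := pi_quot_surj b.
by rewrite [_ * _]pi_quot_mul !quot_map_pi // [RHS]pi_quot_mul.
Qed.

Lemma quot_mapV N M (a : quot N) : pnormal_set N `<=` pnormal_set M ->
  quot_map M a^-1 = (quot_map M a)^-1.
Proof.
move=> NM; have [x ->] := pi_quot_surj a.
by rewrite [_^-1]pi_quot_inv !quot_map_pi // [RHS]pi_quot_inv.
Qed.

Definition coset_at N (x : pro_p_completion) : quot N := val x N.

Lemma coset_at_inj (x y : pro_p_completion) :
  (forall N, coset_at N x = coset_at N y) -> x = y.
Proof.
move=> xy; apply: val_inj; apply: functional_extensionality_dep => N.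
exact: xy.
Qed.

Lemma coset_at_compatible (x : pro_p_completion) N M :
  pnormal_set N `<=` pnormal_set M -> quot_map M (coset_at N x) = coset_at M x.
Proof. by move=> NM; have /set_mem := valP x; apply. Qed.

Definition of_coset_at (f : forall N, quot N)
  (fP : forall N M, pnormal_set N `<=` pnormal_set M ->
        quot_map M (f N) = f M) : pro_p_completion :=
  SigSub (mem_set (fP : inverse_limit f)).

Fact completion_one_subproof N M : pnormal_set N `<=` pnormal_set M ->
  quot_map M (1 : quot N) = 1.
Proof. exact: quot_map_pi. Qed.

Definition completion_one : pro_p_completion :=
  of_coset_at completion_one_subproof.

Fact completion_mul_subproof (x y : pro_p_completion) N M :
  pnormal_set N `<=` pnormal_set M ->
  quot_map M (coset_at N x * coset_at N y) = coset_at M x * coset_at M y.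
Proof. by move=> NM; rewrite quot_mapM// !coset_at_compatible. Qed.

Definition completion_mul (x y : pro_p_completion) : pro_p_completion :=
  of_coset_at (completion_mul_subproof x y).

Fact completion_inv_subproof (x : pro_p_completion) N M :
  pnormal_set N `<=` pnormal_set M ->
  quot_map M (coset_at N x)^-1 = (coset_at M x)^-1.
Proof. by move=> NM; rewrite quot_mapV// coset_at_compatible. Qed.

Definition completion_inv (x : pro_p_completion) : pro_p_completion :=
  of_coset_at (completion_inv_subproof x).

Fact completion_mulA : associative completion_mul.
Proof. by move=> x y z; apply: coset_at_inj => N; apply: mulgA. Qed.

Fact completion_mul1g : left_id completion_one completion_mul.
Proof. by move=> x; apply: coset_at_inj => N; apply: mul1g. Qed.

Fact completion_mulg1 : right_id completion_one completion_mul.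
Proof. by move=> x; apply: coset_at_inj => N; apply: mulg1. Qed.

Fact completion_mulVg :
  left_inverse completion_one completion_inv completion_mul.
Proof. by move=> x; apply: coset_at_inj => N; apply: mulVg. Qed.

Fact completion_mulgV :
  right_inverse completion_one completion_inv completion_mul.
Proof. by move=> x; apply: coset_at_inj => N; apply: mulgV. Qed.

HB.instance Definition _ := isGroup.Build pro_p_completion
  completion_mulA completion_mul1g completion_mulg1 completion_mulVg
  completion_mulgV.

Lemma coset_atM N (x y : pro_p_completion) :
  coset_at N (x * y) = coset_at N x * coset_at N y.
Proof. by []. Qed.

Lemma coset_atV N (x : pro_p_completion) : coset_at N x^-1 = (coset_at N x)^-1.
Proof. by []. Qed.

Lemma nbhs_coset_at (x : pro_p_completion) N :
  nbhs x [set y | coset_at N y = coset_at N x].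
Proof.
have c1 : continuous (val : pro_p_completion -> quot_product).
  exact: initial_continuous.
have c2 := @proj_continuous {classic pnormal p G}
  (fun N => discrete_topology (quot N)) N (val x).
have := discrete_set1 (val x N : discrete_topology (quot N)).
by move=> /c2/c1.
Qed.

Lemma cvg_coset_at (F : set_system pro_p_completion) (x : pro_p_completion) :
  Filter F -> (forall N, F [set y | coset_at N y = coset_at N x]) -> F --> x.
Proof.
move=> FF Fx A [_ [[B Bop <-] Bx BA]].
have : (val @ F) --> (val x : quot_product).
  apply/cvg_sup => N C [_ [[D Dop <-] Dx DC]].
  suff: F (val @^-1` C) by [].
  apply: filterS (Fx N) => y yx; apply: DC.
  have {}yx : coset_at N y = coset_at N x := yx.
  by move: Dx; rewrite /= -[\val x N]/(coset_at N x) -yx.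
move=> /(_ B); have : nbhs (val x : quot_product) B by apply: open_nbhs_nbhs.
move=> /[swap] /[apply] FB; rewrite nbhs_filterE; exact: filterS BA FB.
Qed.

Fact completion_mul_continuous :
  continuous (fun xy : pro_p_completion * pro_p_completion => xy.1 * xy.2).
Proof.
move=> [x y]; apply: cvg_coset_at => N /=.
exists ([set z | coset_at N z = coset_at N x],
        [set z | coset_at N z = coset_at N y]).
  by split; exact: nbhs_coset_at.
by move=> [a b] [/= ax bY]; rewrite /= !coset_atM ax bY.
Qed.

Fact completion_inv_continuous :
  continuous (fun x : pro_p_completion => x^-1).
Proof.
move=> x; have ? : Filter (nbhs x) := nbhs_filter x.
apply: cvg_coset_at => N; apply: filterS (nbhs_coset_at x N) => y yx.
have {}yx : coset_at N y = coset_at N x := yx.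
by rewrite /= !coset_atV yx.
Qed.

HB.instance Definition _ := isTopologicalGroup.Build pro_p_completion
  completion_mul_continuous completion_inv_continuous.

Lemma finite_quot N : finite_set [set: quot N].
Proof.
have [k Nk] := pnormal_index N.
have fin : finite_set (left_cosets [set: G] (pnormal_set N)).
  by apply/finite_setP; exists (p ^ k)%N.
pose f (C : set G) : quot N := \pi_(quot N) (xget 1 C).
apply: sub_finite_set (finite_image f fin) => a _.
have [x ->] := pi_quot_surj a.
exists [set x * b | b in pnormal_set N]; first by exists x.
apply/eq_quotP; case: xgetP => [_ -> [b Nb <-]|/(_ x) []].
  by rewrite invgM -mulgA mulVg mulg1; exact: pnormalV.
by exists 1; [exact: pnormal1|rewrite mulg1].
Qed.

Fact completion_hausdorff : hausdorff_space pro_p_completion.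
Proof.
move=> x y xy; apply: coset_at_inj => N.
by have [z [/= <- <-]] := xy _ _ (nbhs_coset_at x N) (nbhs_coset_at y N).
Qed.

Fact completion_zero_dimensional : zero_dimensional pro_p_completion.
Proof.
move=> x y /eqP xy.
have [N Nxy] : exists N, coset_at N x <> coset_at N y.
  by apply/existsNP => xyE; apply: xy; exact: coset_at_inj.
have op (D : set (quot N)) : open (coset_at N @^-1` D).
  rewrite openE => z Dz; rewrite /interior.
  apply: filterS (nbhs_coset_at z N) => t tz.
  have {}tz : coset_at N t = coset_at N z := tz.
  by rewrite /= tz.
exists (coset_at N @^-1` [set coset_at N x]); split => //=; last exact/nesym.
split; first exact: op.
by rewrite -openC; exact: (op (~` [set coset_at N x])).
Qed.

Fact completion_compact : compact [set: pro_p_completion].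
Proof.
have prodc : compact [set: quot_product].
  have fc N : compact [set: discrete_topology (quot N)].
    by apply: finite_compact; exact: finite_quot.
  have := @tychonoff {classic pnormal p G} _ _ fc.
  by congr (compact _); apply/seteqP; split.
move=> F FF _.
have [x [_ xF]] := prodc (val @ F) _ filterT.
have nbhsx N : nbhs x [set y : quot_product | y N = x N].
  have c := @proj_continuous {classic pnormal p G}
    (fun N => discrete_topology (quot N)) N x.
  by have /c := discrete_set1 (x N : discrete_topology (quot N)).
have xP : inverse_limit x.
  move=> N M NM.
  have FT : (val @ F) [set y | inverse_limit y].
    suff: F (val @^-1` [set y | inverse_limit y]) by [].
    apply: filterS (@filterT _ F _) => y _.
    exact: (set_mem (valP y)).
  have [y [cy [/= <- <-]]] := xF _ _ FT (filterI (nbhsx N) (nbhsx M)).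
  exact: cy.
exists (SigSub (mem_set xP)); split=> // A B FA [_ [[D Dop <-] Dx DB]].
have FvA : (val @ F) (val @` A).
  suff: F (val @^-1` (val @` A)) by [].
  by apply: filterS FA => y Ay; exists y.
have nD : nbhs (x : quot_product) D by apply: open_nbhs_nbhs.
have [_ [[y Ay <-] Dy]] := xF _ _ FvA nD.
by exists y; split=> //; exact: DB.
Qed.

HB.instance Definition _ := isProfinite.Build pro_p_completion
  completion_compact completion_hausdorff
  (zero_dimension_totally_disconnected completion_zero_dimensional).

Definition completion_map (g : G) : pro_p_completion :=
  of_coset_at (fun N M => @quot_map_pi N M g).

Fact completion_mapM : {morph completion_map : x y / x * y}.
Proof.
by move=> x y;
  apply: coset_at_inj => N; rewrite coset_atM [RHS]pi_quot_mul.
Qed.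

HB.instance Definition _ :=
  isMultiplicative.Build G pro_p_completion completion_map completion_mapM.

End ProPCompletion.

(* Main.v *)
From HB Require Import structures.
Require Import Defs.
From mathcomp Require Import all_boot all_classical topology.
From mathcomp Require Import ssralg zmodp fingroup pgroup gproduct cyclic zify.

(** Let Q be the image of Gamma in a finite p-group, A1 and A2 the images of
    H1 and H2 in Q, and C their intersection.

    Necessity.  If P is a product of d procyclic subgroups, every finite
    p-quotient of Gamma of exponent e has order at most e ^ d
    ([bounded_generation_bound]), so it suffices to find finite p-quotients
    whose orders outgrow every fixed power of their exponents.  If (a) and (b)
    both fail, then, up to exchanging the two factors, some Q satisfies
    [A1 : C] >= 2 and [A2 : C] >= 3 ([hyperbolic_quotient_exists]).  Consider
    the bipartite graph with edges Q / C and vertices Q / A1 and Q / A2.  The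
    kernel of the map from A1 *_C A2 to Q is its fundamental group, and the
    first homology of the graph has rank at least
    r = [Q : C] - [Q : A1] - [Q : A2], which is at least [Q : C] / 6.
    No tree is needed to extend Q by this homology with coefficients in Z/q:
    in the wreath product of Z/q with Q, keep H1 in the complement Q and
    conjugate H2 by the indicator function of the edge C.  Since C fixes that
    edge, the two maps agree on K, and the universal property of Gamma glues
    them ([amalgam_wreath]).  The image has order at least |Q| q ^ r
    ([wreath_count]) and exponent dividing q |Q|.  The construction neither
    shrinks A1 or A2 nor enlarges C, so iterating it with q = p makes r larger
    than any given d ([hyperbolic_quotient_large]); after that, q = p ^ n with n
    large yields orders above the d-th power of the exponent
    ([hyperbolic_quotient_unbounded]).

    Sufficiency.  By compactness each V_i is covered by a finite product of
    procyclic subgroups ([closure_range_product]), and V1 and V2 generate P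
    topologically ([completion_generated]).  In case (a) this makes P equal to
    V1 or to V2.  In case (b) choose a in V1 and b in V2 outside B.  Then B is
    normal in P, the quotient P / B is generated by the involutions a and b, and
    so P is the product of V1 and of the closures of the subgroups generated by
    a b and by a, as in a dihedral group ([boundedly_generated_index2]). *)

Set Implicit Arguments.
Unset Strict Implicit.
Unset Printing Implicit Defensive.

Local Open Scope classical_set_scope.

(** * Homomorphisms to finite groups and their images *)

Section Multiplicative.
Local Open Scope group_scope.
Variables (G H : groupType) (f : {multiplicative G -> H}).

Lemma multiplicative1 : f 1 = 1.
Proof. by apply: (mulIg (f 1)); rewrite -gmulfM !mul1g. Qed.

Lemma multiplicativeV x : f x^-1 = (f x)^-1.
Proof.
by apply: (mulIg (f x)); rewrite -gmulfM !mulVg multiplicative1.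
Qed.

Lemma multiplicativeX x n : f (x ^+ n) = f x ^+ n.
Proof.
elim: n => [|n IH]; first by rewrite !expg0 multiplicative1.
by rewrite !expgS gmulfM IH.
Qed.

End Multiplicative.

Section MultiplicativeImage.
Local Open Scope group_scope.
Variables (G : groupType) (E : finGroupType) (f : {multiplicative G -> E}).

Definition mimage_set : {set E} := finset (fun t => `[< exists g, f g = t >]).

Lemma mimageP t : reflect (exists g, f g = t) (t \in mimage_set).
Proof. by rewrite finset.in_set; exact: asboolP. Qed.

Lemma mem_mimage g : f g \in mimage_set. Proof. by apply/mimageP; exists g. Qed.

Fact mimage_group_set : group_set mimage_set.
Proof.
apply/group_setP; split=> [|_ _ /mimageP[x <-] /mimageP[y <-]].
  by apply/mimageP; exists 1; exact: multiplicative1.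
by rewrite -gmulfM mem_mimage.
Qed.

Definition mimage : {group E} := Group mimage_group_set.

End MultiplicativeImage.

Lemma mimage_comp_sub (H G : groupType) (E : finGroupType)
    (f : {multiplicative G -> E}) (i : {multiplicative H -> G}) :
  mimage (f \o i) \subset mimage f.
Proof. by apply/fintype.subsetP => _ /mimageP[h <-]; exact: mem_mimage. Qed.

(** * The wreath product of Z/q with a finite group *)

Section Wreath.
Local Open Scope group_scope.
Variables (q : nat) (E : finGroupType).

(** The permutational wreath product of Z/q with E over the left translation
    action of E on its subsets.  Labelling all subsets lets one group contain
    the chains on E / C for every subgroup C at once. *)
Definition wreath : Type := ({ffun {set E} -> 'Z_q} * E)%type.
HB.instance Definition _ := Finite.on wreath.

(** A constructor of its own keeps pairs from being read in the direct product
    of the two factors. *)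
Definition Wreath (x : {ffun {set E} -> 'Z_q}) (g : E) : wreath := (x, g).

Definition translate (g : E) (x : {ffun {set E} -> 'Z_q}) :
  {ffun {set E} -> 'Z_q} := [ffun S : {set E} => x (g^-1 *: S)].

Lemma translate1 x : translate 1 x = x.
Proof. by apply/ffunP => S; rewrite ffunE invg1 lcoset1. Qed.

Lemma translateM g h x : translate (g * h) x = translate g (translate h x).
Proof. by apply/ffunP => S; rewrite !ffunE invMg lcosetM. Qed.

Lemma translateD g x y :
  translate g (x + y)%R = (translate g x + translate g y)%R.
Proof. by apply/ffunP => S; rewrite !ffunE. Qed.

Lemma translate0 g : translate g 0%R = 0%R.
Proof. by apply/ffunP => S; rewrite !ffunE. Qed.

Lemma translateN g x : translate g (- x)%R = (- translate g x)%R.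
Proof. by apply/ffunP => S; rewrite !ffunE. Qed.

Definition wreath_mul (a b : wreath) : wreath :=
  Wreath (a.1 + translate a.2 b.1)%R (a.2 * b.2).
Definition wreath_inv (a : wreath) : wreath :=
  Wreath (- translate a.2^-1 a.1)%R a.2^-1.

Fact wreath_mulA : associative wreath_mul.
Proof.
move=> [x g] [y h] [z k]; rewrite /wreath_mul /=.
by rewrite translateD translateM GRing.addrA mulgA.
Qed.

Fact wreath_mul1g : left_id (Wreath 0%R 1) wreath_mul.
Proof.
by move=> [x g]; rewrite /wreath_mul /= translate1 GRing.add0r mul1g.
Qed.

Fact wreath_mulg1 : right_id (Wreath 0%R 1) wreath_mul.
Proof.
by move=> [x g]; rewrite /wreath_mul /= translate0 GRing.addr0 mulg1.
Qed.

Fact wreath_mulVg : left_inverse (Wreath 0%R 1) wreath_inv wreath_mul.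
Proof. by move=> [x g]; rewrite /wreath_mul /= GRing.addNr mulVg. Qed.

Fact wreath_mulgV : right_inverse (Wreath 0%R 1) wreath_inv wreath_mul.
Proof.
move=> [x g]; rewrite /wreath_mul /= translateN -translateM mulgV translate1.
by rewrite GRing.subrr.
Qed.

HB.instance Definition _ := isGroup.Build wreath
  wreath_mulA wreath_mul1g wreath_mulg1 wreath_mulVg wreath_mulgV.

Definition wreath_proj (a : wreath) : E := a.2.

Fact wreath_projM : {morph wreath_proj : a b / a * b}. Proof. by []. Qed.

HB.instance Definition _ :=
  isMultiplicative.Build wreath E wreath_proj wreath_projM.

Lemma wreathM x g y h :
  Wreath x g * Wreath y h = Wreath (x + translate g y)%R (g * h).
Proof. by []. Qed.

Lemma wreath_div x y g : Wreath x g * (Wreath y g)^-1 = Wreath (x - y)%R 1.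
Proof.
have -> : (Wreath y g)^-1 = Wreath (- translate g^-1 y)%R g^-1 by [].
by rewrite wreathM translateN -translateM mulgV translate1.
Qed.

Lemma wreath_pgroup (p : nat) : (1 < q)%N -> p.-nat q -> p.-group [set: E]%G ->
  p.-group [set: wreath]%G.
Proof.
move=> q1 qp; rewrite /pgroup !cardsT => Ep.
have -> : #|{: wreath}| = (#|{ffun {set E} -> 'Z_q}| * #|E|)%N.
  exact: card_prod.
rewrite pnatM Ep andbT card_ffun card_ord Zp_cast //.
by rewrite pnatX qp.
Qed.

Lemma labels_char (x : {ffun {set E} -> 'Z_q}) : (1 < q)%N -> (x *+ q = 0)%R.
Proof.
move=> q1; apply/ffunP => S; rewrite ffunMnE ffunE.
apply: val_inj; rewrite /= Zp_mulrn /=; move: (nat_of_ord (x S)) => k.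
by rewrite Zp_cast // modnMl.
Qed.

(** Raising to the power #|E| lands in the base group, which q kills. *)
Lemma wreath_exp (a : wreath) : (1 < q)%N -> a ^+ (q * #|E|) = 1.
Proof.
move=> q1; rewrite mulnC expgM.
have : wreath_proj (a ^+ #|E|) = 1.
  by rewrite multiplicativeX -cardsT; apply: expg_cardG; rewrite inE.
case: (a ^+ #|E|) => x _ /= ->.
suff -> n : (Wreath x 1) ^+ n = Wreath (x *+ n)%R 1 by rewrite labels_char.
elim: n => // n IH.
by rewrite expgS IH wreathM mulg1 translate1 GRing.mulrS.
Qed.

End Wreath.

(** * A lower bound from the homology of the coset graph *)

Section WreathCount.
Local Open Scope group_scope.
Variables (q : nat) (E : finGroupType) (Q A1 A2 C : {group E}).
Hypotheses (q1 : (1 < q)%N) (sAQ1 : A1 \subset Q) (sAQ2 : A2 \subset Q).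
Hypotheses (sCA1 : C \subset A1) (sCA2 : C \subset A2).
Local Notation M := {ffun {set E} -> 'Z_q}.

Definition delta (S : {set E}) : M := [ffun D => (D == S)%:R]%R.

Lemma translate_delta g S : translate g (delta S) = delta (g *: S).
Proof.
apply/ffunP => D; rewrite !ffunE; congr (_%:R)%R.
by congr nat_of_bool; apply/eqP/eqP => [<-|->]; rewrite ?lcosetKV ?lcosetK.
Qed.

Variable R : {group wreath q E}.
Hypothesis RQ : forall g, g \in Q -> exists x, Wreath x g \in R.
Hypothesis RA1 : forall a, a \in A1 -> Wreath 0%R a \in R.
Hypothesis RA2 : forall a, a \in A2 ->
  Wreath (delta C - delta (a *: C)%g)%R a \in R.

(** L is the kernel of the projection of R to E, and s a section of that
    projection over Q. *)
Let L : {set M} := finset (fun x : M => Wreath x 1 \in R).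
Let s (g : E) : M := odflt 0%R [pick x : M | Wreath x g \in R].

Let sR g : g \in Q -> Wreath (s g) g \in R.
Proof.
by move=> /RQ [x xR]; rewrite /s; case: pickP => //= /(_ x); rewrite xR.
Qed.

Let L_div x y g : Wreath x g \in R -> Wreath y g \in R -> (x - y)%R \in L.
Proof. by move=> xR yR; rewrite inE -(wreath_div x y g) groupM ?groupV. Qed.

Let L0 : 0%R \in L. Proof. by rewrite inE (group1 R). Qed.

Let LD x y : x \in L -> y \in L -> (x + y)%R \in L.
Proof.
rewrite !inE => xR yR; have := groupM xR yR.
by rewrite wreathM translate1 mulg1.
Qed.

Let LMn x n : x \in L -> (x *+ n)%R \in L.
Proof. by move=> xL; elim: n => [//|n IH]; rewrite GRing.mulrS; exact: LD. Qed.

Let card_L : (#|Q| * #|L| <= #|R|)%N.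
Proof.
pose f (u : E * M) : wreath q E := Wreath (u.2 + s u.1)%R u.1.
have fi : injective f.
  by move=> [g x] [h y] [] /[swap] /= -> /GRing.addIr ->.
rewrite -cardsX -(card_imset _ fi); apply: subset_leq_card.
apply/fintype.subsetP => y /imsetP[[g x]].
rewrite finset.in_setX inE /= => /andP[gQ xR] ->{y}.
have -> : f (g, x) = Wreath x 1 * Wreath (s g) g.
  by rewrite wreathM translate1 mul1g.
by rewrite groupM // sR.
Qed.

(** Modulo L, the section s only depends on the vertex g A1 of the coset graph,
    and s g plus the label of the edge g C only depends on the vertex g A2.  The
    two functions below are these potentials, evaluated at a representative
    element of the vertex. *)
Let pot1 (S : {set E}) : M := s (repr S).
Let pot2 (S : {set E}) : M := (s (repr S) + translate (repr S) (delta C))%R.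

(** Modulo L, the label of an edge is the difference of the potentials of its
    two ends. *)
Let delta_mod_L D : D \in lcosets C Q ->
  (delta D - (pot2 (D * A2)%g - pot1 (D * A1)%g))%R \in L.
Proof.
move=> /lcosetsP[g gQ ->{D}].
have mulA (A : {group E}) : C \subset A -> g *: C * A = g *: A.
  by move=> sCA; rewrite -!mulgA mulSGid.
rewrite !mulA // -translate_delta /pot1 /pot2.
have /lcosetP[a1 a1A e1] : repr (g *: A1) \in g *: A1.
  by apply: (mem_repr g); rewrite lcoset_refl.
have /lcosetP[a2 a2A e2] : repr (g *: A2) \in g *: A2.
  by apply: (mem_repr g); rewrite lcoset_refl.
set h1 := repr (g *: A1) in e1 *; set h2 := repr (g *: A2) in e2 *.
have l1 : (s h1 - s g)%R \in L.
  apply: (@L_div _ _ h1).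
    by rewrite sR // e1 groupM // (fintype.subsetP sAQ1).
  have := groupM (sR gQ) (RA1 a1A).
  by rewrite wreathM translate0 GRing.addr0 -e1.
have l2 :
    (s g + (translate g (delta C) - translate h2 (delta C)) - s h2)%R \in L.
  apply: (@L_div _ _ h2); last first.
    by rewrite sR // e2 groupM // (fintype.subsetP sAQ2).
  have := groupM (sR gQ) (RA2 a2A).
  by rewrite wreathM -translate_delta translateD translateN -translateM -e2.
have := LD l1 l2; congr (_ \in L).
set X := translate _ _; set Y := translate _ _.
rewrite !GRing.addrA GRing.subrK GRing.opprB GRing.opprD (GRing.addrCA X).
by rewrite -!GRing.addrA (GRing.addrC (- s h2)%R).
Qed.

(** With A equal to A1 or A2, this is the component of the graph boundary of the
    chain y on the vertices of that type. *)
Let boundary (A : {set E}) (y : M) : M :=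
  [ffun S => (\sum_(D in lcosets C Q | (D * A)%g == S) y D)%R].

Let boundaryB A y z :
  boundary A (y - z)%R = (boundary A y - boundary A z)%R.
Proof.
apply/ffunP => S; rewrite !ffunE -GRing.sumrB.
by apply: eq_bigr => D _; rewrite !ffunE.
Qed.

Let boundary_supp (A : {group E}) y : C \subset A ->
  boundary A y \in pffun_on 0%R (lcosets A Q) predT.
Proof.
move=> sCA; apply/pffun_onP; split=> //; apply/fintype.subsetP => S.
rewrite inE ffunE; apply: contraR.
move=> SA; rewrite big_pred0 // => D; apply/negP => /andP[/lcosetsP[g gQ ->]].
rewrite -mulgA mulSGid // => /eqP gS; move: SA.
by rewrite -gS; apply/negP; rewrite negbK; apply/lcosetsP; exists g.
Qed.

(** The residue k acts on labels through its representative below q, so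
    additivity in k relies on q annihilating the labels. *)
Let MnZ (z : M) (k l : 'Z_q) : (z *+ ((k + l)%R : 'Z_q) = z *+ k + z *+ l)%R.
Proof.
rewrite -GRing.mulrnDr /=; move: (nat_of_ord k + nat_of_ord l)%N => n.
have -> : (n %% (Zp_trunc q).+2 = n %% q)%N by rewrite Zp_cast.
rewrite [in RHS](divn_eq n q) GRing.mulrnDr mulnC GRing.mulrnA.
by rewrite labels_char // GRing.mul0rn GRing.add0r.
Qed.

Let Mn_sum (z : M) I (r : seq I) (P : pred I) (F : I -> 'Z_q) :
  (z *+ ((\sum_(i <- r | P i) F i)%R : 'Z_q) = \sum_(i <- r | P i) z *+ F i)%R.
Proof.
have e0 : (z *+ (0%R : 'Z_q) = 0)%R by apply: GRing.mulr0n.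
exact: (big_morph (fun k : 'Z_q => z *+ k)%R (MnZ z) e0).
Qed.

(** Every cycle of the coset graph lies in L: expanding y along its edges and
    regrouping the potentials by vertices, each vertex contributes its
    potential times the boundary coefficient of y there, which is zero. *)
Let cycle_mem y : y \in pffun_on 0%R (lcosets C Q) predT ->
  boundary A1 y = 0%R -> boundary A2 y = 0%R -> y \in L.
Proof.
move=> /pffun_onP[/fintype.subsetP yC _] y1 y2.
have by_chain (A : {group E}) (r : {set E} -> M) : boundary A y = 0%R ->
    (\sum_(D in lcosets C Q) r (D * A)%g *+ y D = 0)%R.
  move=> yA; rewrite (partition_big (fun D : {set E} => D * A)%g predT) //=.
  apply: big1 => S _.
  rewrite (eq_bigr (fun D => r S *+ y D)%R) => [|D /andP[_ /eqP->] //].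
  rewrite -Mn_sum; have /ffunP/(_ S) := yA; rewrite !ffunE => ->.
  by rewrite GRing.mulr0n.
have -> : y = (\sum_(D in lcosets C Q) delta D *+ y D)%R.
  apply/ffunP => S; rewrite sum_ffunE.
  under eq_bigr => D _ do rewrite ffunMnE ffunE.
  have [SC|SC] := boolP (S \in lcosets C Q).
    rewrite (bigD1 S) //= eqxx big1 => [|D /andP[_ /negPf DS]].
      by rewrite GRing.addr0 natr_Zp.
    by rewrite eq_sym DS GRing.mul0rn.
  rewrite big1 => [|D DC]; first by apply/eqP; apply: contraNT SC => /yC.
  by case: eqP SC DC => [->/negPf->//|]; rewrite GRing.mul0rn.
pose l D : M := (delta D - (pot2 (D * A2)%g - pot1 (D * A1)%g))%R.
have -> : (\sum_(D in lcosets C Q) delta D *+ y D =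
           \sum_(D in lcosets C Q) l D *+ y D)%R.
  rewrite (eq_bigr (fun D => l D *+ y D +
      (pot2 (D * A2)%g *+ y D - pot1 (D * A1)%g *+ y D))%R) => [|D _].
    by rewrite big_split /= GRing.sumrB !by_chain // GRing.subr0 GRing.addr0.
  by rewrite -!GRing.mulrnBl -GRing.mulrnDl GRing.subrK.
apply: (big_ind (fun x => x \in L)) => // D DC.
by apply: LMn; exact: delta_mod_L.
Qed.

(** The chains on Q / C, all q ^ [Q : C] of them, are sent by the boundary into
    a set of size q ^ ([Q : A1] + [Q : A2]), with fibres of size at most #|L|
    because cycles lie in L; and #|Q| * #|L| is at most #|R|. *)
Lemma wreath_count :
  (#|Q| * q ^ #|Q : C| <= #|R| * q ^ (#|Q : A1| + #|Q : A2|))%N.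
Proof.
pose Y (A : {set E}) :=
  finset (mem (pffun_on (0%R : 'Z_q) (lcosets A Q) predT)).
have cardY (A : {group E}) : #|Y A| = (q ^ #|Q : A|)%N.
  by rewrite cardsE card_pffun_on card_lcosets card_ord Zp_cast.
pose bd (y : M) := (boundary A1 y, boundary A2 y).
(* [lift] chooses a chain in each fibre of the boundary. *)
pose lift (b : M * M) : M := odflt 0%R [pick y in Y C | bd y == b].
pose f (y : M) := ((y - lift (bd y))%R, bd y).
have fi : injective f.
  move=> y z fyz; have byz : bd y = bd z := congr1 snd fyz.
  have : (y - lift (bd y) = z - lift (bd z))%R := congr1 fst fyz.
  by rewrite byz => /GRing.addIr.
have fY : f @: Y C \subset finset.setX L (finset.setX (Y A1) (Y A2)).
  apply/fintype.subsetP => u /imsetP[y yY ->{u}].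
  rewrite !finset.in_setX; apply/and3P; split; last 2 first.
  - by rewrite finset.in_set; exact: boundary_supp.
  - by rewrite finset.in_set; exact: boundary_supp.
  rewrite /f /lift; case: pickP => [z|/(_ y)]; last by rewrite yY eqxx.
  rewrite finset.in_set in yY.
  rewrite finset.in_set => /andP[zY /eqP[z1 z2]] /=.
  apply: cycle_mem; rewrite ?boundaryB ?z1 ?z2 ?GRing.subrr //.
  move: yY zY => /pffun_onP[/fintype.subsetP sy _].
  move=> /pffun_onP[/fintype.subsetP sz _].
  apply/pffun_onP; split=> //; apply/fintype.subsetP => S.
  rewrite inE !ffunE; apply: contraR => SC.
  have [/eqP -> /eqP ->] := (contraNT (@sy S) SC, contraNT (@sz S) SC).
  by rewrite GRing.subrr.
have : (#|Y C| <= #|L| * (#|Y A1| * #|Y A2|))%N.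
  by rewrite -!cardsX -(card_imset _ fi); exact: subset_leq_card.
rewrite !cardY -expnD => LY.
apply: leq_trans (leq_mul (leqnn _) LY) _.
by rewrite mulnA leq_mul2r card_L orbT.
Qed.

End WreathCount.

(** * Extending a finite quotient of the amalgam *)

Section WreathMorphisms.
Local Open Scope group_scope.
Variables (q : nat) (H : groupType) (E : finGroupType).
Variable pi : {multiplicative H -> E}.

Lemma base_morphism :
  exists m : {multiplicative H -> wreath q E},
    forall h, m h = Wreath 0%R (pi h).
Proof.
pose m h : wreath q E := Wreath 0%R (pi h).
have mM : {morph m : x y / x * y}.
  by move=> x y; rewrite /m wreathM translate0 GRing.addr0 gmulfM.
pose f : {multiplicative H -> wreath q E} :=
  HB.pack m (isMultiplicative.Build _ _ m mM).
by exists f.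
Qed.

(** This is [base_morphism] conjugated by the base element [delta C]; the two
    agree exactly on the stabilizer of C. *)
Lemma conj_morphism (C : {set E}) :
  exists m : {multiplicative H -> wreath q E},
    forall h, m h = Wreath (delta q C - delta q (pi h *: C)%g)%R (pi h).
Proof.
pose m h : wreath q E := Wreath (delta q C - delta q (pi h *: C)%g)%R (pi h).
have mM : {morph m : x y / x * y}.
  move=> x y; rewrite /m wreathM !gmulfM translateD translateN !translate_delta.
  by rewrite -lcosetM GRing.addrA GRing.subrK.
pose f : {multiplicative H -> wreath q E} :=
  HB.pack m (isMultiplicative.Build _ _ m mM).
by exists f.
Qed.

End WreathMorphisms.

Section AmalgamExtension.
Local Open Scope group_scope.
Variables (K H1 H2 Gamma : groupType).
Variables (j1 : {multiplicative K -> H1}) (j2 : {multiplicative K -> H2}).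
Variables (i1 : {multiplicative H1 -> Gamma}).
Variables (i2 : {multiplicative H2 -> Gamma}).
Hypothesis amalgam : is_amalgam j1 j2 i1 i2.

(** The elements coming from K act in C, where conjugating by [delta C] does
    nothing; hence the plain map on H1 and the conjugated map on H2 glue. *)
Lemma amalgam_wreath (E : finGroupType) (pi : {multiplicative Gamma -> E}) q
    (C : {group E}) : mimage (pi \o i1) :&: mimage (pi \o i2) \subset C ->
  exists f : {multiplicative Gamma -> wreath q E},
    [/\ forall g, (f g).2 = pi g,
        forall h, f (i1 h) = Wreath 0%R (pi (i1 h)) &
        forall h, f (i2 h) =
          Wreath (delta q C - delta q (pi (i2 h) *: C)%g)%R (pi (i2 h))].
Proof.
move=> sC; have [_ _ ij univ] := amalgam.
have [m1 m1E] := base_morphism q (pi \o i1).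
have [m2 m2E] := conj_morphism q (pi \o i2) C.
have m12 : m1 \o j1 =1 m2 \o j2.
  move=> k; rewrite /= m1E m2E /=; have /= <- := ij k.
  have kC : pi (i1 (j1 k)) \in C.
    apply: (fintype.subsetP sC); rewrite finset.inE; apply/andP; split.
      exact: (mem_mimage (pi \o i1)).
    by have /= -> := ij k; exact: (mem_mimage (pi \o i2)).
  by rewrite lcoset_id // GRing.subrr.
have [f [fi1 fi2 _]] := univ _ m1 m2 m12.
exists f; split=> [|h|h]; last 2 first.
- by have /= -> := fi1 h; rewrite m1E.
- by have /= -> := fi2 h; rewrite m2E.
(* Both f followed by the projection and pi solve the same gluing problem. *)
have [u [_ _ uu]] := univ _ (pi \o i1) (pi \o i2) (fun k => congr1 pi (ij k)).
move=> g; have -> : pi g = u g by exact: uu.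
apply: (uu (@wreath_proj q E \o f)) => h /=.
  by have /= -> := fi1 h; rewrite m1E.
by have /= -> := fi2 h; rewrite m2E.
Qed.

(** The projection to E maps the new images of H1 and H2 onto the old ones, and
    is injective on that of H1, which lies in the complement.  Hence the images
    of the factors do not shrink and their intersection does not grow, which is
    what iterating the construction requires. *)
Lemma amalgam_extension (E : finGroupType) (pi : {multiplicative Gamma -> E})
    (p n : nat) : prime p -> (0 < n)%N -> p.-group [set: E]%G ->
  let Q := mimage pi in
  let A1 := mimage (pi \o i1) in let A2 := mimage (pi \o i2) in
  exists (T : finGroupType) (f : {multiplicative Gamma -> T}),
    [/\ p.-group [set: T]%G, forall t : T, t ^+ (p ^ n * #|E|) = 1,
        [/\ #|A1| <= #|mimage (f \o i1)|, #|A2| <= #|mimage (f \o i2)| &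
          #|mimage (f \o i1) :&: mimage (f \o i2)| <= #|A1 :&: A2| ]%N &
        (#|Q| * (p ^ n) ^ #|Q : A1 :&: A2| <=
         #|mimage f| * (p ^ n) ^ (#|Q : A1| + #|Q : A2|))%N].
Proof.
move=> p_pr n0 pE Q A1 A2; set q := (p ^ n)%N; set C := (A1 :&: A2)%G.
have q1 : (1 < q)%N by rewrite -(expn0 p) ltn_exp2l // prime_gt1.
have [f [fpi f1 f2]] := @amalgam_wreath _ pi q C (subxx _).
have sAQ1 : A1 \subset Q by apply: mimage_comp_sub.
have sAQ2 : A2 \subset Q by apply: mimage_comp_sub.
exists (wreath q E), f; split.
- by apply: wreath_pgroup => //; rewrite pnatX pnat_id.
- by move=> t; exact: wreath_exp.
- have sub2 (H : groupType) (i : {multiplicative H -> Gamma}) :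
      mimage (pi \o i) \subset @wreath_proj q E @: mimage (f \o i).
    apply/fintype.subsetP => _ /mimageP[h <-]; apply/imsetP.
    by exists (f (i h)); [exact: (mem_mimage (f \o i))|exact/esym/fpi].
  split.
  + by apply: leq_trans (subset_leq_card (sub2 _ _)) _; exact: leq_imset_card.
  + by apply: leq_trans (subset_leq_card (sub2 _ _)) _; exact: leq_imset_card.
  have inj : {in mimage (f \o i1) :&: mimage (f \o i2) &,
              injective (@wreath_proj q E)}.
    move=> _ _ /setIP[/mimageP[h <-] _] /setIP[/mimageP[k <-] _] /=.
    by rewrite !f1 /wreath_proj /= => ->.
  rewrite -(card_in_imset inj); apply: subset_leq_card.
  apply/fintype.subsetP => _ /imsetP[t tf ->]; move: tf.
  move=> /setIP[/mimageP[h ht] /mimageP[k kt]].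
  rewrite finset.inE; apply/andP; split; apply/mimageP.
    by exists h; rewrite -ht /= /wreath_proj fpi.
  by exists k; rewrite -kt /= /wreath_proj fpi.
apply: wreath_count => //.
- exact: subsetIl.
- exact: subsetIr.
- move=> _ /mimageP[g <-]; exists (f g).1; rewrite -fpi.
  have -> : Wreath (f g).1 (f g).2 = f g by case: (f g).
  exact: mem_mimage.
- by move=> _ /mimageP[h <-]; rewrite /= -f1; exact: mem_mimage.
- by move=> _ /mimageP[h <-]; rewrite /= -f2; exact: mem_mimage.
Qed.

End AmalgamExtension.

(** * Quotients whose order outgrows their exponent *)

Section Unbounded.
Local Open Scope group_scope.
Variables (K H1 H2 Gamma : groupType).
Variables (j1 : {multiplicative K -> H1}) (j2 : {multiplicative K -> H2}).
Variables (i1 : {multiplicative H1 -> Gamma}).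
Variables (i2 : {multiplicative H2 -> Gamma}).
Hypothesis amalgam : is_amalgam j1 j2 i1 i2.
Variable p : nat.
Hypothesis p_pr : prime p.

(** The condition 1 / [A1 : C] + 1 / [A2 : C] < 1, that is, a negative Euler
    characteristic, up to exchanging A1 and A2; it is written with orders
    because these are what [amalgam_extension] controls. *)
Definition hyperbolic_quotient (E : finGroupType)
    (pi : {multiplicative Gamma -> E}) : Prop :=
  let A1 := mimage (pi \o i1) in let A2 := mimage (pi \o i2) in
  [/\ p.-group [set: E]%G, (2 * #|A1 :&: A2| <= #|A1|)%N &
      (3 * #|A1 :&: A2| <= #|A2|)%N].

(** Here [Q : A_i] = [Q : C] / [A_i : C], and 1 / 2 + 1 / 3 = 5 / 6. *)
Lemma index_gap (E : finGroupType) (pi : {multiplicative Gamma -> E}) :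
  hyperbolic_quotient pi ->
  (6 * (#|mimage pi : mimage (pi \o i1)| + #|mimage pi : mimage (pi \o i2)|) <=
   5 * #|mimage pi : mimage (pi \o i1) :&: mimage (pi \o i2)|)%N.
Proof.
move=> [_ h1 h2].
set Q := mimage pi; set A1 := mimage (pi \o i1); set A2 := mimage (pi \o i2).
have sAQ1 : A1 \subset Q by apply: mimage_comp_sub.
have sAQ2 : A2 \subset Q by apply: mimage_comp_sub.
have sCQ : A1 :&: A2 \subset Q.
  by apply: fintype.subset_trans (subsetIl _ _) sAQ1.
have := cardG_gt0 (A1 :&: A2)%G.
have := Lagrange sCQ; have := Lagrange sAQ1; have := Lagrange sAQ2 => /=.
move: h1 h2; rewrite -/A1 -/A2.
move: #|Q : _| #|Q : _| #|Q : _| #|Q| #|A1| #|A2| #|A1 :&: A2|.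
move=> e c1 c2 x y1 y2 z h1 h2 l2 l1 l z0.
have : (2 * c1 <= e)%N.
  by rewrite -(leq_pmul2l z0) l -l1 mulnCA mulnA leq_mul2r h1 orbT.
have : (3 * c2 <= e)%N.
  by rewrite -(leq_pmul2l z0) l -l2 mulnCA mulnA leq_mul2r h2 orbT.
lia.
Qed.

(** By [index_gap] an extension with coefficients in Z/p at least doubles the
    order of the quotient, while the intersection C does not grow. *)
Lemma hyperbolic_quotient_large (E : finGroupType)
    (pi : {multiplicative Gamma -> E}) (k : nat) : hyperbolic_quotient pi ->
  exists (T : finGroupType) (f : {multiplicative Gamma -> T}),
    hyperbolic_quotient f /\
    (2 ^ k * #|mimage (f \o i1) :&: mimage (f \o i2)| <= #|mimage f|)%N.
Proof.
move=> hE; elim: k => [|k [T [f [hf fk]]]].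
  exists E, pi; split=> //; rewrite mul1n; apply: subset_leq_card.
  apply/fintype.subsetP => _ /setIP[/mimageP[h <-] _]; exact: mem_mimage.
have [pT h1 h2] := hf; have gap := index_gap hf.
have [T' [f' [pT' _ [c1 c2 c12] cQ]]] :=
  amalgam_extension amalgam (n := 1) f p_pr isT pT.
exists T', f'; split.
  split=> //.
    by apply: leq_trans c1; apply: leq_trans h1; rewrite leq_mul2l c12.
  by apply: leq_trans c2; apply: leq_trans h2; rewrite leq_mul2l c12.
apply: leq_trans (_ : (#|mimage f| * 2 <= _)%N); last first.
  have e0 : (0 < #|mimage f : mimage (f \o i1) :&: mimage (f \o i2)|)%N.
    exact: indexg_gt0.
  move: e0 cQ gap; rewrite expn1.
  move: #|mimage f : _| #|mimage f : _| #|mimage f : _| => a2 a1 e e0 cQ gap.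
  have pa : (0 < p ^ (a1 + a2))%N by rewrite expn_gt0 prime_gt0.
  rewrite -(leq_pmul2r pa); apply: leq_trans cQ.
  rewrite -mulnA leq_mul2l -[leqLHS]/(2 * _)%N; apply/orP; right.
  apply: leq_trans (_ : (p ^ (a1 + a2).+1 <= _)%N); last first.
    by rewrite leq_exp2l ?prime_gt1 //; lia.
  by rewrite expnS leq_mul2r prime_gt1 ?orbT.
rewrite expnS [leqRHS]mulnC -mulnA leq_mul2l /=.
by apply: leq_trans fk; rewrite leq_mul2l c12 orbT.
Qed.

(** Once [Q : C] is at least 6 (d + 1), extending by Z/p^n gives a quotient of
    order at least p ^ (n (d + 1)), whose exponent divides p ^ (n + a) when the
    ambient group has order p ^ a.  Any n above a d is then large enough. *)
Lemma hyperbolic_quotient_unbounded (E : finGroupType)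
    (pi : {multiplicative Gamma -> E}) (d : nat) : hyperbolic_quotient pi ->
  exists (T : finGroupType) (f : {multiplicative Gamma -> T}) (e : nat),
    [/\ p.-group [set: T]%G, (0 < e)%N, forall t : T, t ^+ e = 1 &
        (e ^ d < #|mimage f|)%N].
Proof.
move=> hE; have [T [f [hf fk]]] := hyperbolic_quotient_large (6 * d.+1) hE.
have [pT _ _] := hf; have gap := index_gap hf.
have [a Ta] : exists a, #|T| = (p ^ a)%N.
  by have /p_natP[a Ea] := pT; exists a; rewrite -Ea cardsT.
have [T' [f' [pT' T'exp _ cQ]]] :=
  amalgam_extension amalgam (n := (a * d).+1) f p_pr isT pT.
have p0 := prime_gt0 p_pr.
exists T', f', (p ^ (a * d).+1 * #|T|)%N; split => //.
  by rewrite Ta muln_gt0 !expn_gt0 p0.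
move: cQ gap; rewrite -!expnM Ta -expnD -expnM.
have eb : (6 * d.+1 <= #|mimage f : mimage (f \o i1) :&: mimage (f \o i2)|)%N.
  have sCQ : mimage (f \o i1) :&: mimage (f \o i2) \subset mimage f.
    apply/fintype.subsetP => _ /setIP[/mimageP[h <-] _]; exact: mem_mimage.
  have C0 := cardG_gt0 (mimage (f \o i1) :&: mimage (f \o i2))%G.
  rewrite -(leq_pmul2l C0) Lagrange //=; apply: leq_trans fk.
  by rewrite mulnC leq_mul2r (ltnW (ltn_expl _ _)) ?orbT.
move: #|mimage f : _| #|mimage f : _| #|mimage f : _| eb => a2 a1 e eb cQ gap.
apply: leq_trans (_ : (p ^ ((a * d).+1 * d.+1) <= _)%N).
  by rewrite ltn_exp2l ?prime_gt1 //; lia.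
have pa : (0 < p ^ ((a * d).+1 * (a1 + a2)))%N by rewrite expn_gt0 p0.
rewrite -(leq_pmul2r pa); apply: leq_trans cQ.
apply: leq_trans (_ : (p ^ ((a * d).+1 * e) <= _)%N); last first.
  by rewrite leq_pmull // cardG_gt0.
rewrite -expnD -mulnDr leq_exp2l ?prime_gt1 // leq_mul2l; lia.
Qed.

End Unbounded.

(** * Finite quotients as finite groups *)

Section FiniteQuotients.
Local Open Scope group_scope.

Lemma set_bij_card T U (A : set T) (B : set U) (f : T -> U) :
  set_bij A B f -> (A #= B)%card.
Proof. by move=> /Pbij[g _]; exact: pcard_eq g. Qed.

Lemma card_finType (T : finType) k :
  ([set: T] #= `I_k)%card -> #|{: T}| = k.
Proof.
move=> Tk; apply/card_eq_II; apply: card_eq_trans Tk.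
apply: card_eq_trans card_II _; apply: (@set_bij_card _ _ _ _ enum_val).
split=> [//|i j _ _|x _]; first exact: enum_val_inj.
by exists (enum_rank x); rewrite // enum_rankK.
Qed.

Variables (p : nat) (G : groupType).
Implicit Types N M : pnormal p G.

(** The quotients are only known to be finite sets; the enumeration turns them
    into finite types, so that finite group theory applies to them. *)
Definition quot_enum N : seq (quot N) :=
  undup (projT1 (cid ((finite_seqP _).1 (finite_quot N)))).

Fact quot_enumP N : Finite.axiom (quot_enum N).
Proof.
apply: Finite.uniq_enumP; first exact: undup_uniq.
move=> a; rewrite mem_undup; case: cid => s /= sE.
have : [set` s] a by rewrite -sE.
by move=> /= ->.
Qed.

Fact quot_pickleK N : pcancel (index^~ (quot_enum N)) (onth (quot_enum N)).
Proof.
move=> a; have aN : a \in quot_enum N.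
  by rewrite -has_pred1 has_count quot_enumP.
by rewrite onthE (nth_map a) ?index_mem // nth_index.
Qed.

HB.instance Definition _ N := isCountable.Build (quot N) (@quot_pickleK N).
HB.instance Definition _ N := isFinite.Build (quot N) (@quot_enumP N).

Lemma left_coset_quot N g :
  [set g * b | b in pnormal_set N] =
  [set x | \pi_(quot N)%qT x = \pi_(quot N)%qT g].
Proof.
apply/seteqP; split=> [_ [b Nb <-]|x /eq_quotP Nxg] /=.
  by apply/eq_quotP; rewrite invgM -mulgA mulVg mulg1; exact: pnormalV.
exists (g^-1 * x); last by rewrite mulVKg.
by have := pnormalV Nxg; rewrite invgM invgK.
Qed.

Lemma coset_bij N : set_bij [set: quot N] (left_cosets [set: G] (pnormal_set N))
  (fun a => [set x | \pi_(quot N)%qT x = a]).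
Proof.
split=> [a _|a b _ _ ab|_ [g _ <-]].
- by have [g ->] := pi_quot_surj a; exists g => //; exact: left_coset_quot.
- have [g ag] := pi_quot_surj a.
  have : [set x | \pi_(quot N)%qT x = a] g by rewrite /= ag.
  by rewrite ab ag.
- by exists (\pi_(quot N)%qT g) => //; rewrite left_coset_quot.
Qed.

Lemma quot_pgroup N : prime p -> p.-group [set: quot N]%G.
Proof.
move=> p_pr; have [k Nk] := pnormal_index N.
suff qk : #|{: quot N}| = (p ^ k)%N by rewrite /pgroup cardsT qk pnatX pnat_id.
apply: card_finType; apply: card_eq_trans Nk.
exact: set_bij_card (coset_bij N).
Qed.

Fact coset_at_morph N : {morph (@coset_at p G N) : x y / x * y}.
Proof. by []. Qed.

HB.instance Definition _ N := isMultiplicative.Build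
  (pro_p_completion p G) (quot N) (coset_at N) (@coset_at_morph N).

Lemma coset_at_surj N a : exists g, a = coset_at N (completion_map p g).
Proof. by have [g ->] := pi_quot_surj a; exists g. Qed.

(** The index is the order of the image, which is a power of p by Lagrange's
    theorem. *)
Lemma kernel_pnormal (T : finGroupType) (f : {multiplicative G -> T}) :
  prime p -> p.-group [set: T]%G ->
  exists N, forall x, pnormal_set N x <-> f x = 1.
Proof.
move=> p_pr pT; pose N := [set x | f x = 1].
have subN : is_subgroup N.
  split=> [|x y]; rewrite /N /=; first exact: multiplicative1.
  by move=> fx fy; rewrite gmulfM multiplicativeV fx fy invg1 mulg1.
have conjN x y : N x -> N (x ^ y).
  by rewrite /N /= !gmulfM multiplicativeV => ->; rewrite mul1g mulVg.
have indexN : exists k, has_index [set: G] N (p ^ k)%N.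
  have /p_natP[k kE] : p.-nat #|mimage f|.
    by have := pgroupS (finset.subsetT (mimage f)) pT.
  exists k; rewrite -kE /has_index card_eq_sym.
  pose e i := nth 1 (enum (mimage f)) i.
  have coset g : [set g * b | b in N] = [set x | f x = f g].
    apply/seteqP; split=> [_ [b Nb <-]|x fx] /=.
      by rewrite gmulfM Nb mulg1.
    exists (g^-1 * x); last by rewrite mulVKg.
    by rewrite /N /= gmulfM multiplicativeV fx mulVg.
  apply: (@set_bij_card _ _ _ _ (fun i => [set x | f x = e i])).
  split=> [i /= iN|i j|_ [g _ <-]].
  - have : e i \in mimage f by rewrite -mem_enum mem_nth // -cardE.
    by move=> /mimageP[g eg]; exists g; rewrite // coset eg.
  - move=> /set_mem iN /set_mem jN ij.
    have : e i \in mimage f by rewrite -mem_enum mem_nth // -cardE.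
    move=> /mimageP[g eg].
    have : [set x | f x = e i] g by [].
    rewrite ij /= eg => eij; apply/eqP.
    by rewrite -(nth_uniq 1 _ _ (enum_uniq (mimage f))) -?cardE //; apply/eqP.
  - exists (index (f g) (enum (mimage f))).
      by rewrite /= cardE index_mem mem_enum mem_mimage.
    by rewrite coset /e nth_index // mem_enum mem_mimage.
by exists (PNormal subN conjN indexN).
Qed.

(** The kernel of the product of the two projections is the intersection. *)
Lemma pnormalI N M : prime p -> exists L : pnormal p G,
  pnormal_set L `<=` pnormal_set N /\ pnormal_set L `<=` pnormal_set M.
Proof.
move=> p_pr.
pose f g : quot N * quot M := (\pi_(quot N)%qT g, \pi_(quot M)%qT g).
have fM : {morph f : x y / x * y}.
  by move=> x y; rewrite /f -!pi_quot_mul.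
pose m : {multiplicative G -> (quot N * quot M)%type} :=
  HB.pack f (isMultiplicative.Build _ _ f fM).
have pT : p.-group [set: (quot N * quot M)%type]%G.
  rewrite /pgroup cardsT card_prod pnatM.
  have := quot_pgroup N p_pr; have := quot_pgroup M p_pr.
  by rewrite /pgroup !cardsT => -> ->.
have [L LE] := kernel_pnormal m p_pr pT.
have inN (D : pnormal p G) x : \pi_(quot D)%qT x = 1 -> pnormal_set D x.
  by move=> /esym/eq_quotP; rewrite invg1 mul1g.
by exists L; split=> x /LE [xN xM]; exact: inN.
Qed.

End FiniteQuotients.

(** * Topology of the pro-p completion *)

Section CompletionTopology.
Local Open Scope group_scope.
Variables (p : nat) (G : groupType).
Hypothesis p_pr : prime p.
Local Notation P := (pro_p_completion p G).
Local Notation rho := (@completion_map p G).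

Lemma coset_at_coarser (N M : pnormal p G) (x y : P) :
  pnormal_set N `<=` pnormal_set M ->
  coset_at N x = coset_at N y -> coset_at M x = coset_at M y.
Proof.
by move=> NM xy; rewrite -(coset_at_compatible x NM) xy coset_at_compatible.
Qed.

Lemma pnormal_inhabited : exists N : pnormal p G, True.
Proof.
have p1 : p.-group [set: 'I_1]%G by rewrite /pgroup cardsT card_ord.
pose f (g : G) : 'I_1 := 1.
have fM : {morph f : x y / x * y} by move=> x y; rewrite /f mulg1.
pose m : {multiplicative G -> 'I_1} :=
  HB.pack f (isMultiplicative.Build _ _ f fM).
by have [N _] := kernel_pnormal m p_pr p1; exists N.
Qed.

(** A single pnormal subgroup suffices, rather than finitely many, because these
    subgroups are closed under intersection. *)
Lemma nbhs_completionP (x : P) (A : set P) :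
  nbhs x A <-> exists N, forall y, coset_at N y = coset_at N x -> A y.
Proof.
split=> [xA|[N NA]]; last by apply: filterS (nbhs_coset_at x N).
pose F : set_system P :=
  [set B | exists N, forall y, coset_at N y = coset_at N x -> B y].
have FF : Filter F.
  split=> [|B C [N NB] [M MC]|B C BC [N NB]].
  - by have [N _] := pnormal_inhabited; exists N.
  - have [L [LN LM]] := pnormalI N M p_pr; exists L => y yx; split.
      by apply: NB; exact: coset_at_coarser yx.
    by apply: MC; exact: coset_at_coarser yx.
  - by exists N => y /NB /BC.
by apply: (@cvg_coset_at p G F x FF) => // N; exists N.
Qed.

Lemma closure_completionP (S : set P) (x : P) :
  closure S x <-> forall N, exists2 y, S y & coset_at N y = coset_at N x.
Proof.
split=> [Sx N|Sx B /nbhs_completionP[N NB]].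
  by have [y [Sy yx]] := Sx _ (nbhs_coset_at x N); exists y.
by have [y Sy yx] := Sx N; exists y; split=> //; exact: NB.
Qed.

Lemma closure_subgroup (S : set P) : is_subgroup S -> is_subgroup (closure S).
Proof.
move=> [S1 SV]; split=> [|x y]; first exact: subset_closure.
move=> /closure_completionP Sx /closure_completionP Sy.
apply/closure_completionP => N; have [x' Sx' xx] := Sx N.
have [y' Sy' yy] := Sy N; exists (x' / y'); first exact: SV.
by rewrite !coset_atM !coset_atV xx yy.
Qed.

(** The universal property of the pro-p completion, with continuity stated as
    factoring through a single finite quotient. *)
Lemma completion_lift (T : finGroupType) (f : {multiplicative G -> T}) :
  p.-group [set: T]%G -> exists phi : {multiplicative P -> T},
    (forall g, phi (rho g) = f g) /\
    exists N, forall x y, coset_at N x = coset_at N y -> phi x = phi y.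
Proof.
move=> pT; have [N NE] := kernel_pnormal f p_pr pT.
pose phi (x : P) : T := f (generic_quotient.repr (coset_at N x)).
have fpi g h : \pi_(quot N)%qT g = \pi_(quot N)%qT h -> f g = f h.
  move=> /eq_quotP/NE; rewrite gmulfM multiplicativeV => gh.
  by apply: (mulgI (f g)^-1); rewrite gh mulVg.
have phiM : {morph phi : x y / x * y}.
  move=> x y; rewrite /phi -gmulfM; apply: fpi.
  by rewrite reprK -pi_quot_mul !reprK.
pose m : {multiplicative P -> T} :=
  HB.pack phi (isMultiplicative.Build _ _ phi phiM).
exists m; split=> [g|]; first by apply: fpi; rewrite reprK.
by exists N => x y xy; rewrite /= /phi xy.
Qed.

Lemma closure_lift (T : finGroupType) (phi : {multiplicative P -> T}) N
    (S : set P) (x : P) :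
  (forall x y, coset_at N x = coset_at N y -> phi x = phi y) ->
  closure S x -> exists2 y, S y & phi x = phi y.
Proof.
move=> phiN /closure_completionP/(_ N)[y Sy yx].
by exists y => //; apply: phiN.
Qed.

(** In a finite group of exponent e each procyclic factor has at most e images,
    since a locally constant map sends the closure of a cyclic subgroup into the
    cyclic subgroup of the image. *)
Lemma bounded_generation_bound (s : seq P) (T : finGroupType)
    (f : {multiplicative G -> T}) (e : nat) :
  prod_sets [seq closure (cyclic_subgroup g) | g <- s] = [set: P] ->
  p.-group [set: T]%G -> (0 < e)%N -> (forall t : T, t ^+ e = 1) ->
  (#|mimage f| <= e ^ size s)%N.
Proof.
move=> sP pT e0 expT; have [phi [phif [N phiN]]] := completion_lift f pT.
suff [A [Ae sA]] : exists A : {set T}, (#|A| <= e ^ size s)%N /\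
    forall x, prod_sets [seq closure (cyclic_subgroup g) | g <- s] x ->
      phi x \in A.
  apply: leq_trans Ae; apply: subset_leq_card.
  apply/fintype.subsetP => _ /mimageP[g <-]; rewrite -phif; apply: sA.
  by rewrite sP.
elim: s {sP} => [|g s [A [Ae sA]]].
  exists [set 1]%SET; split=> [|x /= ->]; first by rewrite cards1.
  by rewrite multiplicative1 finset.inE.
exists (<[phi g]> * A)%g; split.
  rewrite /= expnS.
  have -> : <[phi g]> * A = (fun u => u.1 * u.2) @: finset.setX <[phi g]> A.
    apply/setP => t; apply/mulsgP/imsetP => [[a b aA bA ->]|[[a b]]].
      by exists (a, b); rewrite // finset.in_setX aA bA.
    by rewrite finset.in_setX => /andP[aA bA] ->; exists a b.
  apply: leq_trans (leq_imset_card _ _) _; rewrite cardsX; apply: leq_mul Ae.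
  by apply: dvdn_leq => //; rewrite order_dvdn expT.
move=> _ [a ag [b /sA bA <-]]; rewrite gmulfM; apply/mulsgP.
exists (phi a) (phi b) => //.
have [y [n yE] ->] := closure_lift phiN ag.
case: yE => ->; rewrite ?multiplicativeV multiplicativeX ?groupV.
  by rewrite mem_cycle.
by rewrite mem_cycle.
Qed.

End CompletionTopology.

(** * Subgroups of index two *)

Section IndexTwo.
Local Open Scope group_scope.
Variables (G : groupType) (A B : set G).
Hypotheses (subA : is_subgroup A) (subB : is_subgroup B).

Lemma subgroupV (S : set G) x : is_subgroup S -> S x -> S x^-1.
Proof. by case=> S1 SD Sx; have := SD 1 x S1 Sx; rewrite mul1g. Qed.

Lemma subgroupM (S : set G) x y : is_subgroup S -> S x -> S y -> S (x * y).
Proof.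
move=> subS Sx Sy; rewrite -[y]invgK.
by apply: subS.2 => //; exact: subgroupV.
Qed.

Lemma left_coset_eq x y :
  [set x * b | b in B] = [set y * b | b in B] <-> B (x^-1 * y).
Proof.
split=> [xy|Bxy].
  have : [set y * b | b in B] y by exists 1; [exact: subB.1|rewrite mulg1].
  by rewrite -xy => -[b Bb <-]; rewrite mulKg.
apply/seteqP; split=> _ [b Bb <-].
  exists ((x^-1 * y)^-1 * b); last by rewrite invgM invgK !mulgA mulgV mul1g.
  by apply: subgroupM => //; exact: subgroupV.
exists (x^-1 * y * b); last by rewrite !mulgA mulgV mul1g.
exact: subgroupM.
Qed.

(** Index two in terms of elements: the coset of v is the only other one. *)
Lemma has_index2P : has_index A B 2 <->
  exists v, [/\ A v, ~ B v & forall w, A w -> B w \/ B (v^-1 * w)].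
Proof.
split=> [|[v [Av Bv vB]]].
  rewrite /has_index card_eq_sym => /card_set_bijP[f [fA fI fS]].
  have [i iI f1] := fS [set 1 * b | b in B] (ex_intro2 _ _ 1 subA.1 erefl).
  have i2 : (i < 2)%N by [].
  have i'2 : (1 - i < 2)%N by lia.
  have [v Av fv] := fA (1 - i)%N i'2.
  exists v; split=> // [Bv|w Aw].
    suff: i = (1 - i)%N by clear -i2; lia.
    apply: fI; [exact: mem_set|exact: mem_set|].
    by rewrite f1 -fv; apply/left_coset_eq; rewrite invg1 mul1g.
  have [j jI fj] := fS [set w * b | b in B] (ex_intro2 _ _ w Aw erefl).
  have j2 : (j < 2)%N by [].
  have [ji|ji] : j = i \/ j = (1 - i)%N by clear -i2 j2; lia.
    left; have : B (1^-1 * w) by apply/left_coset_eq; rewrite -f1 -fj ji.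
    by rewrite invg1 mul1g.
  by right; apply/left_coset_eq; rewrite fv -fj ji.
rewrite /has_index card_eq_sym.
apply: (@set_bij_card _ _ _ _
  (fun i => [set (if i is 0 then 1 else v) * b | b in B])).
have neq : [set 1 * b | b in B] <> [set v * b | b in B].
  by move=> /left_coset_eq; rewrite invg1 mul1g.
split=> [i _|[|[|i]] [|[|j]] /set_mem i2 /set_mem j2 //=|_ [w Aw <-]].
- by exists (if i is 0 then 1 else v) => //; case: i => // ; exact: subA.1.
- by move=> /esym.
- have [Bw|Bw] := vB w Aw; [exists 0%N => //|exists 1%N => //].
    by apply/left_coset_eq; rewrite invg1 mul1g.
  exact/left_coset_eq.
Qed.

End IndexTwo.

Lemma subgroupI (G : groupType) (A B : set G) :
  is_subgroup A -> is_subgroup B -> is_subgroup (A `&` B).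
Proof. by move=> [A1 AD] [B1 BD]; split=> // x y [? ?] [? ?]; split; auto. Qed.

Lemma closure_range_subgroup (p : nat) (H G : groupType)
    (i : {multiplicative H -> G}) : prime p ->
  is_subgroup (closure (@completion_map p G @` range i)).
Proof.
move=> p_pr; apply: closure_subgroup => //; split.
  exists 1%g; last exact: multiplicative1.
  by exists 1%g; last exact: multiplicative1.
move=> _ _ [_ [x _ <-] <-] [_ [y _ <-] <-].
exists (i (x / y)%g); first by exists (x / y)%g.
by rewrite !gmulfM !multiplicativeV.
Qed.

(** * Bounded generation forces (a) or (b) *)

Section IndexBounds.
Local Open Scope group_scope.
Variables (gT : finGroupType) (A C : {group gT}).
Hypothesis sCA : C \subset A.

Lemma card_mul_le_index k : (k <= #|A : C|)%N -> (k * #|C| <= #|A|)%N.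
Proof. by move=> kA; rewrite -(Lagrange sCA) mulnC leq_mul2l kA orbT. Qed.

Lemma index_ge3_pgroup p v : prime p -> p != 2 -> p.-group A ->
  v \in A -> v \notin C -> (3 <= #|A : C|)%N.
Proof.
move=> p_pr p2 pA vA vC.
have : (1 < #|A : C|)%N.
  by rewrite indexg_gt1; apply: contra vC => /fintype.subsetP; apply.
have /p_natP[[|j] ->] : p.-nat #|A : C|.
- by apply: pnat_dvd pA; exact: dvdn_indexg.
- by [].
- move=> _; apply: (@leq_trans p).
    by rewrite ltn_neqAle eq_sym p2 prime_gt1.
  by rewrite expnS leq_pmulr // expn_gt0 prime_gt0.
Qed.

Lemma index_ge3 v w : v \in A -> w \in A ->
  v \notin C -> w \notin C -> v^-1 * w \notin C -> (3 <= #|A : C|)%N.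
Proof.
move=> vA wA vC wC vwC; rewrite -card_lcosets.
have coset_neq x y : x^-1 * y \notin C -> x *: C != y *: C.
  by apply: contra => /eqP xy; rewrite -mem_lcoset xy lcoset_refl.
have un : uniq [:: 1 *: C; v *: C; w *: C].
  by rewrite /= !inE negb_or !coset_neq // invg1 mul1g.
rewrite -[3]/(size [:: 1 *: C; v *: C; w *: C]) -(card_uniqP un).
apply: subset_leq_card; apply/fintype.subsetP => S; rewrite !inE.
by case/or3P => /eqP->; apply/lcosetsP; [exists 1|exists v|exists w].
Qed.

End IndexBounds.

Section ForwardDirection.
Local Open Scope group_scope.
Variables (K H1 H2 Gamma : groupType).
Variables (j1 : {multiplicative K -> H1}) (j2 : {multiplicative K -> H2}).
Variables (i1 : {multiplicative H1 -> Gamma}).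
Variables (i2 : {multiplicative H2 -> Gamma}).
Hypothesis amalgam : is_amalgam j1 j2 i1 i2.
Variable p : nat.
Hypothesis p_pr : prime p.
Local Notation P := (pro_p_completion p Gamma).
Local Notation rho := (@completion_map p Gamma).

(** Finitely many points outside a closed set are separated from it in one
    finite quotient. *)
Lemma separate (S : set P) (xs : seq P) :
  (forall x, x \in xs -> ~ closure S x) ->
  exists N, forall x y, x \in xs -> S y -> coset_at N y <> coset_at N x.
Proof.
elim: xs => [_|x xs IH xsS].
  by have [N _] := pnormal_inhabited Gamma p_pr; exists N.
have [|N NS] := IH; first by move=> y yxs; apply: xsS; rewrite inE yxs orbT.
have [M MS] : exists M, forall y, S y -> coset_at M y <> coset_at M x.
  apply: contrapT => noM; apply: (xsS x (mem_head _ _)).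
  apply/(closure_completionP p_pr) => M; apply: contrapT => noy; apply: noM.
  by exists M => y Sy yx; apply: noy; exists y.
have [L [LN LM]] := pnormalI N M p_pr; exists L => z y.
rewrite inE => /orP[/eqP->|zxs] Sy yz.
  by apply: (MS _ Sy); exact: coset_at_coarser yz.
by apply: (NS _ _ zxs Sy); exact: coset_at_coarser yz.
Qed.

Let V1 : set P := closure (rho @` range i1).
Let V2 : set P := closure (rho @` range i2).

(** The hypotheses say that B is proper in V1 and has index at least three in
    V2; for odd p the second claim only needs B proper in V2, as indices are powers
    of p.  The finitely many witnesses survive in one finite quotient. *)
Lemma hyperbolic_quotient_exists (u v : P) :
  V1 u -> ~ V2 u -> V2 v -> ~ V1 v ->
  (p <> 2 \/ exists w, [/\ V2 w, ~ V1 w & ~ V1 (v^-1 * w)]) ->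
  exists (E : finGroupType) (pi : {multiplicative Gamma -> E}),
    hyperbolic_quotient i1 i2 p pi.
Proof.
move=> V1u V2u V2v V1v vw.
(* ws lists the points that have to stay outside the image of H1. *)
have [ws [wsV1 vws Hws]] : exists ws : seq P,
    [/\ forall x, x \in ws -> ~ V1 x, v \in ws &
      p <> 2 \/ exists w, [/\ V2 w, w \in ws & v^-1 * w \in ws]].
  case: vw => [p2|[w [V2w V1w V1vw]]].
    by exists [:: v]; split; [move=> x /[!inE] /eqP->|rewrite inE|left].
  exists [:: v; w; v^-1 * w]; split.
  - by move=> x; rewrite !inE => /or3P[] /eqP->.
  - by rewrite mem_head.
  - by right; exists w; rewrite !inE !eqxx !orbT.
have [N1 N1P] : exists N, forall x y, x \in [:: u] -> (rho @` range i2) y ->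
    coset_at N y <> coset_at N x.
  by apply: separate => x /[!inE] /eqP->.
have [N2 N2P] := separate wsV1.
have [N [NN1 NN2]] := pnormalI N1 N2 p_pr.
pose pi : {multiplicative Gamma -> quot N} := coset_at N \o rho.
exists (quot N), pi.
have inA (H : groupType) (i : {multiplicative H -> Gamma}) x :
    closure (rho @` range i) x -> coset_at N x \in mimage (pi \o i).
  move=> /(closure_completionP p_pr)/(_ N)[_ [_ [h _ <-] <-] <-].
  exact: (mem_mimage (pi \o i)).
have uA2 : coset_at N u \notin mimage (pi \o i2).
  apply/mimageP => -[h hu]; apply: (N1P u (rho (i2 h)) (mem_head _ _)).
    by exists (i2 h) => //; exists h.
  exact: coset_at_coarser hu.
have wA1 x : x \in ws -> coset_at N x \notin mimage (pi \o i1).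
  move=> xws; apply/mimageP => -[h hx]; apply: (N2P x (rho (i1 h)) xws).
    by exists (i1 h) => //; exists h.
  exact: coset_at_coarser hx.
have wC x : x \in ws ->
    coset_at N x \notin (mimage (pi \o i1) :&: mimage (pi \o i2))%G.
  by move=> /wA1; apply: contra => /setIP[].
split; first exact: quot_pgroup.
  apply: (@card_mul_le_index _ _ (mimage (pi \o i1) :&: mimage (pi \o i2))%G).
    exact: subsetIl.
  rewrite indexg_gt1; apply: contra uA2 => /fintype.subsetP sA.
  by have /setIP[] := sA _ (inA _ _ _ V1u).
apply: (@card_mul_le_index _ _ (mimage (pi \o i1) :&: mimage (pi \o i2))%G).
  exact: subsetIr.
case: Hws => [/eqP p2|[w [V2w wws vwws]]].
  apply: (@index_ge3_pgroup _ _ _ p (coset_at N v)) => //.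
  - exact: pgroupS (finset.subsetT _) (quot_pgroup N p_pr).
  - exact: inA.
  - exact: wC.
apply: (@index_ge3 _ _ _ (coset_at N v) (coset_at N w)).
- exact: inA.
- exact: inA.
- exact: wC.
- exact: wC.
- by rewrite -coset_atV -coset_atM; exact: wC.
Qed.

(** Otherwise [hyperbolic_quotient_exists] provides a hyperbolic quotient, and
    [hyperbolic_quotient_unbounded] contradicts [bounded_generation_bound]. *)
Lemma index2_of_boundedly_generated (u v : P) :
  profinite_boundedly_generated P ->
  V1 u -> ~ V2 u -> V2 v -> ~ V1 v ->
  p = 2 /\ has_index V2 (V1 `&` V2) 2.
Proof.
move=> [s sP] V1u V2u V2v V1v.
have abs : ~ (p <> 2 \/ exists w, [/\ V2 w, ~ V1 w & ~ V1 (v^-1 * w)]).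
  move=> /(hyperbolic_quotient_exists V1u V2u V2v V1v) [E [pi hE]].
  have [T [f [e [pT e0 expT]]]] :=
    hyperbolic_quotient_unbounded amalgam p_pr (size s) hE.
  by rewrite ltnNge (bounded_generation_bound p_pr f sP pT e0 expT).
split; first by apply: contrapT => p2; apply: abs; left.
have split2 w : V2 w -> V1 w \/ V1 (v^-1 * w).
  by move=> V2w; apply: contrapT => /not_orP[? ?]; apply: abs; right; exists w.
apply/has_index2P.
- exact: closure_range_subgroup.
- by apply: subgroupI; exact: closure_range_subgroup.
exists v; split=> // [[]//|w V2w].
have [V1w|V1vw] := split2 w V2w; [by left|right; split=> //].
have subV2 : is_subgroup V2 := closure_range_subgroup i2 p_pr.
exact: (subgroupM subV2 (subgroupV subV2 V2v) V2w).
Qed.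

End ForwardDirection.

(** * Two overgroups of index two generate a dihedral extension *)

Section Dihedral.
Local Open Scope group_scope.
Variables (G : groupType) (A1 A2 B : set G) (a b : G).
Hypotheses (subA1 : is_subgroup A1) (subA2 : is_subgroup A2).
Hypotheses (subB : is_subgroup B) (BA1 : B `<=` A1) (BA2 : B `<=` A2).
Hypotheses (A1a : A1 a) (nBa : ~ B a).
Hypothesis A1B : forall w, A1 w -> B w \/ B (a^-1 * w).
Hypotheses (A2b : A2 b) (nBb : ~ B b).
Hypothesis A2B : forall w, A2 w -> B w \/ B (b^-1 * w).

Lemma index2_sqr (A : set G) x : is_subgroup A -> A x -> ~ B x ->
  (forall w, A w -> B w \/ B (x^-1 * w)) -> B (x * x).
Proof.
move=> subA Ax nBx AB; case: (AB (x * x)) => //; first exact: subgroupM.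
by rewrite mulKg.
Qed.

Definition normalizes (x : G) : Prop :=
  forall y, B y -> B (x * y * x^-1) /\ B (x^-1 * y * x).

Lemma index2_normalizes (A : set G) x : is_subgroup A -> B `<=` A ->
  A x -> ~ B x -> (forall w, A w -> B w \/ B (x^-1 * w)) -> normalizes x.
Proof.
move=> subA BA Ax nBx AB y By.
have xx := index2_sqr subA Ax nBx AB.
have xyx : B (x * y * x^-1).
  have Axyx : A (x * y * x^-1).
    by apply: subA.2 => //; apply: subgroupM => //; exact: BA.
  case: (AB _ Axyx) => // Byx; case: nBx; rewrite -[x]invgK.
  apply: subgroupV => //; have := subgroupM subB (subgroupV subB By) Byx.
  by rewrite -(mulgA x) !mulKg.
split=> //; have -> : x^-1 * y * x = (x * x)^-1 * (x * y * x^-1) * (x * x).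
  by rewrite invgM !mulgA !mulgVK.
by apply: subgroupM => //; apply: subgroupM => //; exact: subgroupV.
Qed.

Lemma subgroup_normalizes : is_subgroup normalizes.
Proof.
split=> [y By|x y nx ny z Bz]; first by rewrite invg1 !mul1g !mulg1.
rewrite invgM invgK; split.
  by have := (nx _ (ny _ Bz).2).1; rewrite !mulgA.
by have := (ny _ (nx _ Bz).2).1; rewrite !mulgA.
Qed.

Let c := a * b.

Let na : normalizes a. Proof. exact: (index2_normalizes subA1). Qed.
Let nb : normalizes b. Proof. exact: (index2_normalizes subA2). Qed.

Lemma normalizes_cyclic y : cyclic_subgroup c y -> normalizes y.
Proof.
have nc n : normalizes (c ^+ n).
  elim: n => [|n IH]; first by rewrite expg0; exact: subgroup_normalizes.1.
  rewrite expgS; apply: (subgroupM subgroup_normalizes) IH.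
  exact: (subgroupM subgroup_normalizes).
by case=> n [->|->] //; exact: (subgroupV subgroup_normalizes).
Qed.

(** Modulo B the elements a and b are involutions, so a inverts a b. *)
Lemma cyclic_inverted y : cyclic_subgroup c y -> B (a * y * a^-1 * y).
Proof.
have aa := index2_sqr subA1 A1a nBa A1B.
have bb := index2_sqr subA2 A2b nBb A2B.
have cn n : cyclic_subgroup c (c ^+ n) by exists n; left.
have inv n : B (a * c ^+ n * a^-1 * c ^+ n).
  elim: n => [|n IH].
    by rewrite expg0 !mulg1 mulgV; exact: subB.1.
  have -> : a * c ^+ n.+1 * a^-1 * c ^+ n.+1 =
      (a * a) * (b * b) * (c^-1 * (a * c ^+ n * a^-1 * c ^+ n) * c).
    rewrite {1}expgS expgSr /c invgM !mulgA; congr (_ * _ * _).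
    by rewrite !mulgK mulgVK.
  apply: subgroupM => //; first exact: subgroupM.
  by apply: (normalizes_cyclic (cn 1%N) _).2; rewrite // expg1.
case=> n [->|->] //.
have -> : a * c ^- n * a^-1 * c ^- n =
    (c ^+ n * (a * c ^+ n * a^-1 * c ^+ n) * c ^- n)^-1.
  by rewrite !mulgA mulgK !invgM !invgK !mulgA.
by apply: subgroupV => //; exact: (normalizes_cyclic (cn n) (inv n)).1.
Qed.

(** The preimage of the dihedral group generated by a and b modulo B.  What is
    used is its stability under left multiplication by A1 and A2. *)
Definition dihedral_set : set G :=
  [set x | exists z y, [/\ B z, cyclic_subgroup c y &
                           x = z * y \/ x = z * y * a]].

Lemma dihedral_set1 : dihedral_set 1.
Proof.
exists 1, 1; split; [exact: subB.1|by exists 0%N; left|left].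
by rewrite mulg1.
Qed.

Let dihedralB z x : B z -> dihedral_set x -> dihedral_set (z * x).
Proof.
move=> Bz [t [y [Bt cy xE]]]; exists (z * t), y; split=> //.
  exact: subgroupM.
by case: xE => ->; [left|right]; rewrite !mulgA.
Qed.

Let dihedral_a x : dihedral_set x -> dihedral_set (a * x).
Proof.
move=> [z [y [Bz cy xE]]].
have aza : B (a * z * a^-1) := (na Bz).1.
have cy' : cyclic_subgroup c y^-1.
  by case: cy => n [->|->]; exists n; rewrite ?invgK; [right|left].
have inv := cyclic_inverted cy.
case: xE => ->; [exists (a * z * a^-1 * (a * y * a^-1 * y)) |
    exists (a * z * a^-1 * (a * y * a^-1 * y) * (y^-1 * (a * a) * y))];
  exists y^-1; split=> //.
- exact: subgroupM.
- by right; rewrite !mulgA !(mulgVK, mulgK).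
- apply: subgroupM => //; first exact: subgroupM.
  by apply: (normalizes_cyclic cy _).2; exact: (index2_sqr subA1).
- by left; rewrite !mulgA !(mulgVK, mulgK).
Qed.

Let dihedral_c x : dihedral_set x -> dihedral_set (c * x).
Proof.
move=> [z [y [Bz cy xE]]]; exists (c * z * c^-1), (c * y); split.
- by apply: (normalizes_cyclic _ Bz).1; exists 1%N; left; rewrite expg1.
- case: cy => -[|n] [->|->].
  + by exists 1%N; left; rewrite expg0 mulg1 expg1.
  + by exists 1%N; left; rewrite expg0 invg1 mulg1 expg1.
  + by exists n.+2; left; rewrite [RHS]expgS.
  + by exists n; right; rewrite expgSr invgM mulVKg.
by case: xE => ->; [left|right]; rewrite -(mulgA (c * z) c^-1) mulKg !mulgA.
Qed.

Lemma dihedral_setM1 w x : A1 w -> dihedral_set x -> dihedral_set (w * x).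
Proof.
move=> A1w; have [Bw|Bw] := A1B A1w; first exact: dihedralB.
move=> dx; have -> : w * x = a * ((a^-1 * w) * x) by rewrite !mulgA mulgV mul1g.
exact/dihedral_a/dihedralB.
Qed.

Lemma dihedral_setM2 w x : A2 w -> dihedral_set x -> dihedral_set (w * x).
Proof.
move=> A2w; have [Bw|Bw] := A2B A2w; first exact: dihedralB.
move=> dx; have -> : w * x = (a * a)^-1 * (a * (c * ((b^-1 * w) * x))).
  by rewrite /c invgM !mulgA mulgVK mulVg mul1g mulgV mul1g.
apply: dihedralB; first exact: (subgroupV subB (index2_sqr subA1 A1a nBa A1B)).
exact/dihedral_a/dihedral_c/dihedralB.
Qed.

End Dihedral.

(** * Conditions (a) and (b) imply bounded generation *)

Section BackwardDirection.
Local Open Scope group_scope.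

Section ProductSets.
Variable G : topologicalGroupType.

Lemma compact_mul_set (A B : set G) :
  compact A -> compact B -> compact (mul_set A B).
Proof.
move=> cA cB; have -> : mul_set A B = (fun u : G * G => u.1 * u.2) @` (A `*` B).
  apply/seteqP; split=> [_ [a Aa [b Bb <-]]|_ [[a b] [/= Aa Bb] <-]].
    by exists (a, b).
  by exists a => //; exists b.
apply: continuous_compact; last exact: compact_setX.
by apply: continuous_subspaceT; exact: mulg_continuous.
Qed.

Lemma compact_prod_sets (s : seq (set G)) :
  (forall A, A \in s -> compact A) -> compact (prod_sets s).
Proof.
elim: s => [_|A s IH sc]; first exact: compact_set1.
apply: compact_mul_set; first by apply: sc; rewrite mem_head.
by apply: IH => B Bs; apply: sc; rewrite inE Bs orbT.
Qed.

End ProductSets.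

Lemma prod_sets_cat (G : groupType) (s t : seq (set G)) x y :
  prod_sets s x -> prod_sets t y -> prod_sets (s ++ t) (x * y).
Proof.
elim: s x => [x /= -> |A s IH x [a Aa [b sb <-]] ty]; first by rewrite mul1g.
by exists a => //; exists (b * y); [exact: IH|rewrite mulgA].
Qed.

(** A product of finitely many compact sets is compact, hence closed; this is
    why covering a dense subset is enough. *)
Lemma closed_cyclic_product (G : profiniteGroupType) (s : seq G) :
  closed (prod_sets [seq closure (cyclic_subgroup g) | g <- s]).
Proof.
apply: compact_closed; first exact: profinite_hausdorff.
apply: compact_prod_sets => _ /mapP[g _ ->].
apply: subclosed_compact (@profinite_compact G) _ => //.
exact: closed_closure.
Qed.

Variable p : nat.
Hypothesis p_pr : prime p.

Lemma closure_range_product (H G : groupType) (i : {multiplicative H -> G}) :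
  boundedly_generated H ->
  exists s : seq (pro_p_completion p G),
    closure (@completion_map p G @` range i) `<=`
    prod_sets [seq closure (cyclic_subgroup g) | g <- s].
Proof.
move=> [s sH]; exists [seq completion_map p (i h) | h <- s].
have := @closed_cyclic_product (pro_p_completion p G)
  [seq completion_map p (i h) | h <- s].
move=> /closure_id ->; apply: closureS => _ [_ [h _ <-] <-].
have : prod_sets [seq cyclic_subgroup g | g <- s] h by rewrite sH.
elim: s {sH} h => [h /= ->|g s IH h [x xg [y ys <-]]].
  by rewrite !multiplicative1.
exists (completion_map p (i x)).
  apply: subset_closure; case: xg => n [->|->]; exists n.
    by left; rewrite !multiplicativeX.
  by right; rewrite !multiplicativeV !multiplicativeX.
by exists (completion_map p (i y)); [exact: IH|rewrite !gmulfM].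
Qed.

Section Generation.
Variables (K H1 H2 Gamma : groupType).
Variables (j1 : {multiplicative K -> H1}) (j2 : {multiplicative K -> H2}).
Variables (i1 : {multiplicative H1 -> Gamma}).
Variables (i2 : {multiplicative H2 -> Gamma}).
Hypothesis amalgam : is_amalgam j1 j2 i1 i2.

(** Epimorphisms of groups are surjective.  In the wreath product of Z/2 with E,
    the complement and its conjugate by [delta D] meet in the stabilizer D of
    the coset D.  So the two corresponding maps from Gamma agree on H1 and H2,
    hence are equal, which confines the image of Gamma to D. *)
Lemma amalgam_image_generated (E : finGroupType)
    (pi : {multiplicative Gamma -> E}) (D : {group E}) :
  (forall h, pi (i1 h) \in D) -> (forall h, pi (i2 h) \in D) ->
  forall g, pi g \in D.
Proof.
move=> D1 D2 g; have [_ _ ij univ] := amalgam.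
have [m1 m1E] := base_morphism 2 pi; have [m2 m2E] := conj_morphism 2 pi D.
have [f [_ _ uniq_f]] :=
  univ _ (m1 \o i1) (m1 \o i2) (fun k => congr1 m1 (ij k)).
have m12 : m2 g = m1 g.
  rewrite (uniq_f m1) // (uniq_f m2) // => h /=; rewrite m1E m2E.
    by rewrite lcoset_id // GRing.subrr.
  by rewrite lcoset_id // GRing.subrr.
have : (delta 2 D - delta 2 (pi g *: D)%g)%R = 0%R.
  by move: m12; rewrite m1E m2E => -[].
move=> /ffunP/(_ (pi g *: D)); rewrite !ffunE eqxx.
case: eqP => [gD _|_]; first by rewrite -gD lcoset_refl.
by rewrite GRing.sub0r.
Qed.

Local Notation P := (pro_p_completion p Gamma).
Local Notation rho := (@completion_map p Gamma).
Let V1 : set P := closure (rho @` range i1).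
Let V2 : set P := closure (rho @` range i2).

Lemma completion_generated (S : set P) :
  is_subgroup S -> V1 `<=` S -> V2 `<=` S -> closure S = [set: P].
Proof.
move=> subS V1S V2S; apply/seteqP; split=> // x _.
apply/(closure_completionP p_pr) => N.
pose D := finset (fun a : quot N => `[< exists2 y, S y & coset_at N y = a >]).
have DP a : reflect (exists2 y, S y & coset_at N y = a) (a \in D).
  by rewrite finset.in_set; exact: asboolP.
have gD : group_set D.
  apply/group_setP; split; first by apply/DP; exists 1; [exact: subS.1|].
  move=> _ _ /DP[x1 Sx1 <-] /DP[x2 Sx2 <-]; apply/DP; exists (x1 * x2) => //.
  exact: subgroupM.
have [g ->] := coset_at_surj (coset_at N x).
suff /DP[y Sy yg] : coset_at N (rho g) \in Group gD by exists y.
apply: (@amalgam_image_generated _ (coset_at N \o rho) (Group gD)) => h /=.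
  apply/DP; exists (rho (i1 h)) => //; apply: V1S; apply: subset_closure.
  by exists (i1 h) => //; exists h.
apply/DP; exists (rho (i2 h)) => //; apply: V2S; apply: subset_closure.
by exists (i2 h) => //; exists h.
Qed.

Lemma boundedly_generated_of_factor (S : set P) (s : seq P) :
  is_subgroup S -> V1 `<=` S -> V2 `<=` S ->
  S `<=` prod_sets [seq closure (cyclic_subgroup g) | g <- s] ->
  profinite_boundedly_generated P.
Proof.
move=> subS V1S V2S Ss; exists s; apply/seteqP; split=> // x _.
have := closureS Ss; rewrite completion_generated //.
by rewrite -((closure_id _).1 (@closed_cyclic_product P s)); apply.
Qed.

Lemma boundedly_generated_sub : V1 `<=` V2 -> boundedly_generated H2 ->
  profinite_boundedly_generated P.
Proof.
move=> V12 bg2; have [s V2s] := closure_range_product i2 bg2.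
exact: boundedly_generated_of_factor (closure_range_subgroup i2 p_pr) V12 _ V2s.
Qed.

(** The dihedral set over B lies in the product of V1, of the cyclic subgroup of
    a b and of that of a, and the closures of these factors multiply to a closed
    set. *)
Lemma boundedly_generated_index2 : boundedly_generated H1 ->
  has_index V1 (V1 `&` V2) 2 -> has_index V2 (V1 `&` V2) 2 ->
  profinite_boundedly_generated P.
Proof.
move=> bg1.
have sub1 : is_subgroup V1 := closure_range_subgroup i1 p_pr.
have sub2 : is_subgroup V2 := closure_range_subgroup i2 p_pr.
have subB := subgroupI sub1 sub2.
move=> /(has_index2P sub1 subB)[a [V1a nBa V1B]].
move=> /(has_index2P sub2 subB)[b [V2b nBb V2B]].
have [s V1s] := closure_range_product i1 bg1.
pose W := dihedral_set (V1 `&` V2) a b.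
have W1 w x : V1 w -> W x -> W (w * x).
  exact: (dihedral_setM1 sub1 sub2 subB (@subIsetl _ _ _) (@subIsetr _ _ _)
    V1a nBa V1B V2b nBb V2B).
have W2 w x : V2 w -> W x -> W (w * x).
  exact: (dihedral_setM2 sub1 sub2 subB (@subIsetl _ _ _) (@subIsetr _ _ _)
    V1a nBa V1B V2b nBb V2B).
(* The stabilizer of W under left translation is a subgroup by construction;
   it is contained in W because W contains 1. *)
pose S := [set g : P | forall x, (W x -> W (g * x)) /\ (W x -> W (g^-1 * x))].
have subS : is_subgroup S.
  split=> [x|g h Sg Sh x]; first by rewrite invg1 mul1g.
  rewrite invgM invgK; split=> Wx.
    by rewrite -mulgA; apply: (Sg _).1; apply: (Sh _).2.
  by rewrite -mulgA; apply: (Sh _).1; apply: (Sg _).2.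
apply: (@boundedly_generated_of_factor S (s ++ [:: a * b; a])) => //.
- move=> w V1w x; split; apply: W1 => //; exact: (subgroupV sub1 V1w).
- move=> w V2w x; split; apply: W2 => //; exact: (subgroupV sub2 V2w).
move=> g /(_ 1)[/(_ (dihedral_set1 a b subB)) + _].
rewrite mulg1 map_cat => -[z [y [[V1z _] cy gE]]].
have tail t : cyclic_subgroup a t ->
    prod_sets [seq closure (cyclic_subgroup g) | g <- [:: a * b; a]] (y * t).
  move=> ct; exists y; first exact: subset_closure.
  exists (t * 1); last by rewrite mulg1.
  by exists t; [exact: subset_closure|exists 1].
case: gE => ->.
  rewrite -[z * y]mulg1 -mulgA; apply: prod_sets_cat; first exact: V1s.
  by apply: tail; exists 0%N; left.
rewrite -mulgA; apply: prod_sets_cat; first exact: V1s.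
by apply: tail; exists 1%N; left; rewrite expg1.
Qed.

End Generation.
End BackwardDirection.

Lemma is_amalgam_sym (K H1 H2 G : groupType)
    (j1 : {multiplicative K -> H1}) (j2 : {multiplicative K -> H2})
    (i1 : {multiplicative H1 -> G}) (i2 : {multiplicative H2 -> G}) :
  is_amalgam j1 j2 i1 i2 -> is_amalgam j2 j1 i2 i1.
Proof.
move=> [j1I j2I ij univ]; split=> // T f2 f1 f12.
have [f [fi1 fi2 uf]] := univ T f1 f2 (fun k => esym (f12 k)).
by exists f; split=> // g gi2 gi1; exact: uf.
Qed.

Theorem theorem2 (p : nat) (K H1 H2 Gamma : groupType)
    (j1 : {multiplicative K -> H1}) (j2 : {multiplicative K -> H2})
    (i1 : {multiplicative H1 -> Gamma}) (i2 : {multiplicative H2 -> Gamma}) :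
  prime p ->
  is_amalgam j1 j2 i1 i2 ->
  boundedly_generated H1 ->
  boundedly_generated H2 ->
  let P : profiniteGroupType := pro_p_completion p Gamma in
  let rho : Gamma -> P := @completion_map p Gamma in
  let V1 : set P := closure (rho @` range i1) in
  let V2 : set P := closure (rho @` range i2) in
  let B : set P := V1 `&` V2 in
  profinite_boundedly_generated P <->
    (B = V1 \/ B = V2) \/
    [/\ p = 2, has_index V1 B 2 & has_index V2 B 2].
Proof.
move=> p_pr amalgam bg1 bg2 P rho V1 V2 B.
have amalgam' := is_amalgam_sym amalgam.
split=> [bgP|[[BV|BV]|[_ ind1 ind2]]]; last 1 first.
- exact: (boundedly_generated_index2 p_pr amalgam bg1 ind1 ind2).
- have [V12|/existsNP[u /not_implyP[V1u V2u]]] := pselect (V1 `<=` V2).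
    by left; left; exact/setIidl.
  have [V21|/existsNP[v /not_implyP[V2v V1v]]] := pselect (V2 `<=` V1).
    by left; right; exact/setIidr.
  right; have [p2 ind2] :=
    index2_of_boundedly_generated amalgam p_pr bgP V1u V2u V2v V1v.
  have [_ ind1] :=
    index2_of_boundedly_generated amalgam' p_pr bgP V2v V1v V1u V2u.
  by split=> //; rewrite /B setIC.
- apply: (boundedly_generated_sub p_pr amalgam _ bg2).
  by rewrite -/V1 -BV => x [].
- apply: (boundedly_generated_sub p_pr amalgam' _ bg1).
  by rewrite -/V2 -BV => x [].
Qed.
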